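(* Let $k$ be a field with $\mathrm{char}(k)\neq2$ and let $n\geq1$. Let $A=(a_{ij})\in M_n(k)$, let $\alpha\in k$ be nonzero, let $\gamma=(\gamma_1,\dots,\gamma_n)\in k^n$, let $\Lambda=(\lambda_{ij})$ be a lower triangular $n\times n$ matrix over $k$, and let $\Gamma$ be the $n\times n$ matrix with entries $\Gamma_{ij}=\gamma_i\gamma_j$. Then the cleft extension $Cl(\alpha,\gamma,\Lambda)^{op}$ is $(E(n),r_A)$-Azumaya if and only if $\det(2\alpha(A-\Lambda-\Lambda^t)+\Gamma)\neq0$.
   Context: $E(n)$ is the Hopf algebra over $k$ (of dimension $2^{n+1}$) generated by $c,x_1,\dots,x_n$ with relations $c^2=1$, $cx_i+x_ic=0$, $x_ix_j+x_jx_i=0$, $x_i^2=0$, coproduct $\Delta(c)=c\otimes c$, $\Delta(x_i)=1\otimes x_i+x_i\otimes c$, counit $\varepsilon(c)=1$, $\varepsilon(x_i)=0$, and antipode $S(c)=c$, $S(x_i)=cx_i$. For $P\subseteq\{1,\dots,n\}$, $x_P$ is the product of the $x_j$, $j\in P$, in increasing order; the $c^ax_P$ ($a=0,1$) form a basis and $(\ )^*$ denotes dual basis elements. Universal $r$-form $r_A$ on $E(n)$ attached to $A\in M_n(k)$: $r_A=\sum_P(-1)^{|P|(|P|-1)/2}\sum_{F,|F|=|P|,\eta\in S_{|P|}}\mathrm{sign}(\eta)\,a_{P,\eta(F)}\big((x_P)^*\otimes(x_F)^*+(cx_P)^*\otimes(x_F)^*+(-1)^{|P|}(x_P)^*\otimes(cx_F)^*-(-1)^{|P|}(cx_P)^*\otimes(cx_F)^*\big)$,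 where $P=\{p_1<\dots<p_s\}$, $F=\{f_1<\dots<f_s\}$ range over subsets of $\{1,\dots,n\}$ and $a_{P,\eta(F)}=a_{p_1,f_{\eta(1)}}\cdots a_{p_s,f_{\eta(s)}}$ (equal to $1$ if $P=\emptyset$). $Cl(\alpha,\gamma,\Lambda)$ is the $E(n)$-cleft extension of $k$, i.e. the right $E(n)$-comodule algebra, generated by $u,v_1,\dots,v_n$ with relations $u^2=\alpha$, $uv_i+v_iu=\gamma_i$, $v_j^2=\lambda_{jj}$, $v_iv_j+v_jv_i=\lambda_{ij}$ for $i>j$, with coaction the algebra map determined by $\rho(u)=u\otimes c$, $\rho(v_j)=1\otimes x_j+v_j\otimes c$. $Cl(\alpha,\gamma,\Lambda)^{op}$ is its opposite algebra with the same coaction; it is a right $E(n)^{op}$-comodule algebra. $(H,r)$-Azumaya, for a finite-dimensional Hopf algebra $H$ with universal $r$-form $r$ (Sweedler notation $\rho(a)=\sum a_{(0)}\otimes a_{(1)}$): let $A$ be a finite-dimensional right $H^{op}$-comodule algebra, i.e. a right $H$-comodule and an algebra with $\rho(1)=1\otimes1$ and $\rho(ab)=\sum a_{(0)}b_{(0)}\otimes b_{(1)}a_{(1)}$. Its opposite $\overline A$ is $A$ as a comodule, with product $a\circ b=\sum b_{(0)}a_{(0)}\,r(b_{(1)}\otimes a_{(1)})$. For two such algebras $A,B$, $A\#B$ is $A\otimes B$ with product $(a\#b)(c\#d)=\sum (a c_{(0)}\#b_{(0)}d)\,r(c_{(1)}\otimes b_{(1)})$. $A$ is $(H,r)$-Azumaya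 if the $H^{op}$-comodule algebra maps $F\colon A\#\overline A\to End(A)$, $F(a\#\bar b)(c)=\sum a\,c_{(0)}b_{(0)}\,r(c_{(1)}\otimes b_{(1)})$, and $G\colon\overline A\#A\to End(A)^{op}$, $G(\bar a\#b)(c)=\sum r(a_{(1)}\otimes c_{(1)})\,a_{(0)}c_{(0)}b$, are both isomorphisms (equivalently, bijective). *)

(* Defs.v *)
From HB Require Import structures.
From mathcomp Require Import all_boot all_order all_algebra all_fingroup.
From mathcomp Require Import all_field.

Set Implicit Arguments.
Unset Strict Implicit.
Unset Printing Implicit Defensive.

Import GRing.Theory.
Local Open Scope ring_scope.

(* The tensor product of two finite-dimensional spaces, as the space of
   coordinate matrices in the library's bases [vbasis].  For a bilinear [f],
   [tsum^~ f] is the linear map V (x) W -> U with v (x) w |-> f v w (see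
   [tsum_tens]); in Sweedler notation, for t = \sum t_(0) (x) t_(1), the value
   [tsum t f] is \sum f(t_(0), t_(1)). *)
Notation tprod V W := 'M_(\dim (@fullv _ V), \dim (@fullv _ W)).

Section Tensor.
Variables (k : fieldType) (V W : vectType k).

Definition tens (v : V) (w : W) : tprod V W :=
  \matrix_(i, j) (coord (vbasis {:V}) i v * coord (vbasis {:W}) j w).

Definition tsum (U : lmodType k) (t : tprod V W) (f : V -> W -> U) : U :=
  \sum_i \sum_j t i j *: f (vbasis {:V})`_i (vbasis {:W})`_j.

Lemma tsum_tens (U : lmodType k) (f : V -> W -> U) v w :
    (forall w', linear (f^~ w')) -> (forall v', linear (f v')) ->
  tsum (tens v w) f = f v w.
Proof.
move=> linl linr.
have f0l w' : f 0 w' = 0.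
  by have := linl w' (-1) 0 0; rewrite scaler0 addr0 scaleN1r addNr.
have f0r v' : f v' 0 = 0.
  by have := linr v' (-1) 0 0; rewrite scaler0 addr0 scaleN1r addNr.
have suml n (a : 'I_n -> k) (e : 'I_n -> V) w' :
    f (\sum_i a i *: e i) w' = \sum_i a i *: f (e i) w'.
  elim: n a e => [|n IHn] a e; first by rewrite !big_ord0 f0l.
  by rewrite !big_ord_recl linl IHn.
have sumr n (a : 'I_n -> k) (e : 'I_n -> W) v' :
    f v' (\sum_i a i *: e i) = \sum_i a i *: f v' (e i).
  elim: n a e => [|n IHn] a e; first by rewrite !big_ord0 f0r.
  by rewrite !big_ord_recl linr IHn.
rewrite {2}(coord_vbasis (memvf v)) {2}(coord_vbasis (memvf w)) suml.
apply: eq_bigr => i _; rewrite sumr scaler_sumr.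
by apply: eq_bigr => j _; rewrite mxE scalerA.
Qed.

End Tensor.

(* The library equips B^c (B with its product reversed) only with a ring
   structure; it keeps the vector space structure of B. *)
Section Converse.
Variables (k : fieldType) (B : falgType k).

HB.instance Definition _ := Vector.copy B^c B.

Fact converse_scalerAl (a : k) (x y : (B^c : nzRingType)) :
  a *: (x * y : B^c) = (a *: (x : B^c) : (B^c : nzRingType)) * y.
Proof. exact: (@scalerAr k B a y x). Qed.
HB.instance Definition _ :=
  GRing.Lmodule_isLalgebra.Build k B^c converse_scalerAl.

Fact converse_scalerAr (a : k) (x y : (B^c : nzRingType)) :
  a *: (x * y : B^c) = x * (a *: (y : B^c) : (B^c : nzRingType)).
Proof. exact: (@scalerAl k B a y x). Qed.
HB.instance Definition _ :=
  GRing.Lalgebra_isAlgebra.Build k B^c converse_scalerAr.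

End Converse.

Record hopfAlgebra (k : fieldType) := HopfAlgebra {
  hopf_alg :> falgType k;
  comul : 'Hom(hopf_alg, tprod hopf_alg hopf_alg);
  counit : 'Hom(hopf_alg, k^o);
  antipode : 'End(hopf_alg);
  comul1 : comul 1 = tens 1 1;
  comulM : forall a b, comul (a * b) =
    tsum (comul a) (fun a1 a2 =>
      tsum (comul b) (fun b1 b2 => tens (a1 * b1) (a2 * b2)));
  counit1 : counit 1 = 1;
  counitM : forall a b, counit (a * b) = counit a * counit b;
  comulA : forall a,
    tsum (comul a) (fun a1 a2 => tens (comul a1) a2) =
    tsum (comul a) (fun a1 a2 =>
      tsum (comul a2) (fun a21 a22 => tens (tens a1 a21) a22));
  counitl : forall a, tsum (comul a) (fun a1 a2 => counit a1 *: a2) = a;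
  counitr : forall a, tsum (comul a) (fun a1 a2 => counit a2 *: a1) = a;
  antipodel : forall a,
    tsum (comul a) (fun a1 a2 => antipode a1 * a2) = (counit a)%:A;
  antipoder : forall a,
    tsum (comul a) (fun a1 a2 => a1 * antipode a2) = (counit a)%:A
}.

Arguments comul {k h}.
Arguments counit {k h}.
Arguments antipode {k h}.

Section Comodule.
Variables (k : fieldType) (H : hopfAlgebra k) (A : falgType k).
Variable rho : 'Hom(A, tprod A H).

Definition is_comodule : Prop :=
  (forall a, tsum (rho a) (fun a0 a1 => tens (rho a0) a1) =
     tsum (rho a) (fun a0 a1 =>
       tsum (comul a1) (fun a11 a12 => tens (tens a0 a11) a12))) /\
  (forall a, tsum (rho a) (fun a0 a1 => counit a1 *: a0) = a).

Definition is_comodule_algebra : Prop :=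
  [/\ is_comodule, rho 1 = tens 1 1 & forall a b, rho (a * b) =
    tsum (rho a) (fun a0 a1 =>
      tsum (rho b) (fun b0 b1 => tens (a0 * b0) (a1 * b1)))].

Definition is_op_comodule_algebra : Prop :=
  [/\ is_comodule, rho 1 = tens 1 1 & forall a b, rho (a * b) =
    tsum (rho a) (fun a0 a1 =>
      tsum (rho b) (fun b0 b1 => tens (a0 * b0) (b1 * a1)))].

Variable r : H -> H -> k.

(* The maps F : A # Abar -> End(A) and G : Abar # A -> End(A)^op.  The
   braided products on the underlying space A (x) A of A # Abar and Abar # A
   make F and G algebra maps, but they do not enter in their values. *)
Definition azumayaF (t : tprod A A) : 'End(A) :=
  tsum t (fun a b => linfun (fun c : A =>
    tsum (rho c) (fun c0 c1 =>
      tsum (rho b) (fun b0 b1 => r c1 b1 *: (a * c0 * b0))))).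

Definition azumayaG (t : tprod A A) : 'End(A) :=
  tsum t (fun a b => linfun (fun c : A =>
    tsum (rho a) (fun a0 a1 =>
      tsum (rho c) (fun c0 c1 => r a1 c1 *: (a0 * c0 * b))))).

Definition azumaya : Prop :=
  [/\ is_op_comodule_algebra, bijective azumayaF & bijective azumayaG].

End Comodule.

Section Presentation.
Variables (k : fieldType) (n : nat).

(* B is the k-algebra generated by u, v_1, ..., v_n with relations [rel]: it is
   initial among the k-algebras with elements satisfying [rel]. *)
Definition is_presented
    (rel : forall C : algType k, C -> ('I_n -> C) -> Prop)
    (B : algType k) (u : B) (v : 'I_n -> B) : Prop :=
  rel B u v /\
  forall (C : algType k) (u' : C) (v' : 'I_n -> C), rel C u' v' ->
    exists f : {lrmorphism B -> C},
      (f u = u' /\ forall i, f (v i) = v' i) /\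
      forall g : {lrmorphism B -> C},
        g u = u' -> (forall i, g (v i) = v' i) -> g =1 f.

Definition En_rel (C : algType k) (c : C) (x : 'I_n -> C) : Prop :=
  [/\ c ^+ 2 = 1,
      forall i, c * x i + x i * c = 0,
      forall i j, x i * x j + x j * x i = 0
    & forall i, x i ^+ 2 = 0].

Definition is_En (H : hopfAlgebra k) (c : H) (x : 'I_n -> H) : Prop :=
  [/\ is_presented En_rel c x,
      comul c = tens c c /\
        forall i, comul (x i) = tens 1 (x i) + tens (x i) c,
      counit c = 1 /\ forall i, counit (x i) = 0
    & antipode c = c /\ forall i, antipode (x i) = c * x i].

Definition Cl_rel (alpha : k) (gamma : 'rV[k]_n) (Lambda : 'M[k]_n)
    (C : algType k) (u : C) (v : 'I_n -> C) : Prop :=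
  [/\ u ^+ 2 = alpha%:A,
      forall i, u * v i + v i * u = (gamma 0 i)%:A,
      forall j, v j ^+ 2 = (Lambda j j)%:A
    & forall i j : 'I_n, (j < i)%N ->
        v i * v j + v j * v i = (Lambda i j)%:A].

Definition is_Cl (H : hopfAlgebra k) (c : H) (x : 'I_n -> H)
    (alpha : k) (gamma : 'rV[k]_n) (Lambda : 'M[k]_n)
    (B : falgType k) (u : B) (v : 'I_n -> B) (rho : 'Hom(B, tprod B H)) :=
  [/\ is_presented (Cl_rel alpha gamma Lambda) u v,
      is_comodule_algebra rho,
      rho u = tens u c
    & forall j, rho (v j) = tens 1 (x j) + tens (v j) c].

Section RForm.
Variables (H : hopfAlgebra k) (c : H) (x : 'I_n -> H).

Definition xprod (P : {set 'I_n}) : H := \prod_(i <- enum P) x i.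

(* The basis of the c^a x_P, with a Boolean for the exponent a. *)
Definition En_basis : #|{: bool * {set 'I_n}}|.-tuple H :=
  [tuple let: (a, P) := enum_val i in c ^+ a * xprod P
     | i < #|{: bool * {set 'I_n}}|].

Definition En_dual (a : bool) (P : {set 'I_n}) : H -> k :=
  coord En_basis (enum_rank (a, P)).

(* [enum_val] lists P increasingly, and so does [enum F]; the default value of
   [nth] is never reached when #|F| = #|P|. *)
Definition rA_coef (A : 'M[k]_n) (P F : {set 'I_n}) (eta : 'S_#|P|) : k :=
  \prod_(i < #|P|) A (enum_val i) (nth (enum_val i) (enum F) (eta i)).

Definition rA (A : 'M[k]_n) (h g : H) : k :=
  \sum_(P : {set 'I_n}) (-1) ^+ (#|P| * (#|P| - 1))./2 *
  \sum_(F : {set 'I_n} | #|F| == #|P|) \sum_(eta : 'S_#|P|)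
    (-1) ^+ eta * rA_coef A F eta *
    (En_dual false P h * En_dual false F g
     + En_dual true P h * En_dual false F g
     + (-1) ^+ #|P| * (En_dual false P h * En_dual true F g)
     - (-1) ^+ #|P| * (En_dual true P h * En_dual true F g)).

End RForm.

End Presentation.

(* Main.v *)
From HB Require Import structures.
Require Import Defs.
From mathcomp Require Import all_boot all_order all_algebra all_fingroup.
From mathcomp Require Import all_field ring.

(** Let B be the algebra Cl with its product reversed, and let e be the family
    (u, v_1, ..., v_n) of its generators. An element of the dual of E(n) acts on
    every comodule. The character gam of E(n) with gam(c) = -1, gam(x_i) = 0 acts
    on B as the parity automorphism g, and the functional phi_j which vanishes at
    1 and c and takes the value a_ij at x_i, and is skew multiplicative with
    respect to the counit and gam, acts as a skew derivation D_j, with D_j(u) = 0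
    and D_j(v_i) = a_ij.

    The form r_A is an iterated contraction: r_A(h, 1) is the counit of h,
    r_A(h, c l) = r_A(g h, l) and r_A(h, x_j l) = r_A(D_j h, l)
    ([rA_is_pairing]). A form with these properties exists because
    g and the D_j satisfy the relations of E(n), and its values on the basis
    c^a x_P are, up to sign, the minors of A that define r_A, since the contraction of
    a word in the x_i by D_j is a Laplace expansion along a column
    ([pairing_word]). By induction it has the mirror properties in its first
    argument ([pairing_cr], [pairing_xr]).

    Write F(a # b) = L_a R_b, with L_a the left multiplication by a in B and
    R_b(d) = \sum d_0 b_0 r_A(d_1, b_1). The rules for r_A say that R_1 is the
    identity and R_(b e_j)(d) = R_b(D_j d) + R_b(g d) e_j, where D_j = 0 for the
    generator u. They imply that the span of the L_a R_b is stable under left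
    composition with the L_a and the R_(e_j), so that it contains the algebra that
    these generate. Let Q be the Gram matrix of the relations,
    e_i e_j + e_j e_i = Q_ij, and let W have the entries D_j(e_i), that is, W is A
    bordered by zeros. The differences N_j = R_(e_j) - L_(e_j) satisfy N_j(1) = 0
    and N_j L_(e_i) + L_(e_i) N_j = W_ij - Q_ij ([annihilation_e]).

    If W - Q is invertible, suitable combinations of the N_j are annihilation
    operators dual to the L_(e_i), and B is a Fock space for them with vacuum 1.
    Such a representation is irreducible in the strong sense that the operators
    generate the whole algebra End(B) ([fock_irreducible]); hence F is surjective,
    and bijective because the dimensions agree. Exchanging the two sides, the same
    argument applies to G ([multiplications_span] serves for both).

    If W - Q is singular, some combination \sum w_j N_j with w <> 0 anticommutes
    with all L_(e_i) and kills 1, so it is 0. Then F kills 1 # y - y # 1 for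
    y = \sum w_j e_j, and the coaction shows that y is a scalar only if w = 0; so F
    is not injective. Finally the Schur complement of the entry - 2 alpha of W - Q turns
    det(W - Q) into the determinant of the theorem, up to a nonzero factor
    ([det_forms]). *)

Set Implicit Arguments.
Unset Strict Implicit.
Unset Printing Implicit Defensive.

Import GRing.Theory.
Local Open Scope ring_scope.

(** * Tensors and linear maps *)

Section TensorSums.
Variables (k : fieldType) (V W : vectType k).

Lemma eq_tsum (U : lmodType k) (t : tprod V W) (f f' : V -> W -> U) :
  (forall v w, f v w = f' v w) -> tsum t f = tsum t f'.
Proof. by move=> ff'; apply: eq_bigr => i _; apply: eq_bigr => j _; rewrite ff'. Qed.

Lemma tsum_is_linear (U : lmodType k) (f : V -> W -> U) :
  linear (fun t : tprod V W => tsum t f).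
Proof.
move=> a t s; rewrite /tsum scaler_sumr -big_split; apply: eq_bigr => i _ /=.
rewrite scaler_sumr -big_split; apply: eq_bigr => j _ /=.
by rewrite !mxE scalerDl scalerA.
Qed.

Lemma tsumDr (U : lmodType k) (t : tprod V W) (f f' : V -> W -> U) :
  tsum t (fun v w => f v w + f' v w) = tsum t f + tsum t f'.
Proof.
rewrite /tsum -big_split; apply: eq_bigr => i _ /=.
by rewrite -big_split; apply: eq_bigr => j _; rewrite /= scalerDr.
Qed.

Lemma tsumD (U : lmodType k) (f : V -> W -> U) (t s : tprod V W) :
  tsum (t + s) f = tsum t f + tsum s f.
Proof. by have := tsum_is_linear f 1 t s; rewrite !scale1r. Qed.

Lemma tsum0 (U : lmodType k) (f : V -> W -> U) : tsum 0 f = 0.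
Proof.
by rewrite /tsum big1 // => i _; rewrite big1 // => j _; rewrite mxE scale0r.
Qed.

Lemma linear_tsum (U U' : lmodType k) (h : U -> U') (t : tprod V W) (f : V -> W -> U) :
  linear h -> h (tsum t f) = tsum t (fun v w => h (f v w)).
Proof.
move=> lin_h.
pose hL : {linear U -> U'} := HB.pack h (GRing.isLinear.Build k U U' _ h lin_h).
rewrite -[h]/(hL : U -> U') /tsum linear_sum; apply: eq_bigr => i _.
by rewrite linear_sum; apply: eq_bigr => j _; rewrite linearZ.
Qed.

Lemma tens_linl (w : W) : linear (fun v : V => tens v w).
Proof. by move=> a v v'; apply/matrixP => i j; rewrite !mxE linearP mulrDl mulrA. Qed.

Lemma tens_linr (v : V) : linear (fun w : W => tens v w).
Proof. by move=> a w w'; apply/matrixP => i j; rewrite !mxE linearP mulrDr mulrCA. Qed.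

End TensorSums.

Lemma tsum_linear_fun (k : fieldType) (V W : vectType k) (U U' : lmodType k)
    (t : tprod V W) (f : U -> V -> W -> U') :
  (forall v w, linear (fun x => f x v w)) -> linear (fun x => tsum t (f x)).
Proof.
move=> lin_f a x y; rewrite (eq_tsum t (fun v w => lin_f v w a x y)) tsumDr.
congr (_ + _); apply: esym; rewrite (linear_tsum t (f x)) // => b u v.
by rewrite scalerDr !scalerA mulrC.
Qed.

Lemma exchange_tsum (k : fieldType) (V W V' W' : vectType k) (U : lmodType k)
    (t : tprod V W) (s : tprod V' W') (f : V -> W -> V' -> W' -> U) :
  tsum t (fun v w => tsum s (f v w)) =
  tsum s (fun v' w' => tsum t (fun v w => f v w v' w')).
Proof.
have sum_tsum (I : finType) (F : I -> V' -> W' -> U) :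
    \sum_i tsum s (F i) = tsum s (fun v' w' => \sum_i F i v' w').
  rewrite /tsum exchange_big; apply: eq_bigr => i _.
  by rewrite exchange_big; apply: eq_bigr => j _; rewrite scaler_sumr.
have scale_tsum a (F : V' -> W' -> U) :
    a *: tsum s F = tsum s (fun v' w' => a *: F v' w').
  rewrite /tsum scaler_sumr; apply: eq_bigr => i _; rewrite scaler_sumr.
  by apply: eq_bigr => j _; rewrite !scalerA mulrC.
rewrite {1}/tsum.
under eq_bigr => i _.
  under eq_bigr => j _ do rewrite scale_tsum.
  rewrite sum_tsum.
over.
by rewrite sum_tsum.
Qed.

(** Substitution of a sum of pure tensors in a sum over a tensor; all Sweedler
    computations below are compositions of this rule with [exchange_tsum]. *)
Lemma tsum_tsum_tens (k : fieldType) (V W V' W' : vectType k) (U : lmodType k)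
    (t : tprod V W) (f : V -> W -> V') (h : V -> W -> W') (F : V' -> W' -> U) :
    (forall w, linear (F^~ w)) -> (forall v, linear (F v)) ->
  tsum (tsum t (fun v w => tens (f v w) (h v w))) F =
  tsum t (fun v w => F (f v w) (h v w)).
Proof.
move=> linl linr; rewrite (linear_tsum _ _ (tsum_is_linear F)).
by apply: eq_tsum => v w; rewrite tsum_tens.
Qed.

Lemma tsum_tr (k : fieldType) (V W : vectType k) (U : lmodType k) (t : tprod V W)
    (f : W -> V -> U) : tsum t^T f = tsum t (fun v w => f w v).
Proof.
rewrite /tsum exchange_big; apply: eq_bigr => i _; apply: eq_bigr => j _.
by rewrite mxE.
Qed.

Section LinearAlgebra.
Variable k : fieldType.

(** [linfun f] is only meaningful for a linear [f]; agreement with a linear map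
    provides that. *)
Lemma linfun_ext (V W : vectType k) (f : V -> W) (X : 'Hom(V, W)) :
  (forall d, f d = X d) -> linfun f = X.
Proof.
move=> fX; have f_lin : linear f by move=> a x y; rewrite !fX linearP.
pose fL : {linear V -> W} := HB.pack f (GRing.isLinear.Build k V W _ f f_lin).
by apply/lfunP => d; rewrite -fX; apply: (lfunE fL).
Qed.

Lemma bilinear_hom (V : vectType k) (f : V -> V -> V) :
    (forall d, linear (f^~ d)) -> (forall b, linear (f b)) ->
  exists R : 'Hom(V, 'End(V)), forall b d, R b d = f b d.
Proof.
move=> f_linl f_linr.
pose fr b : {linear V -> V} := HB.pack (f b) (GRing.isLinear.Build k V V _ _ (f_linr b)).
pose h b : 'End(V) := linfun (fr b).
have hE b d : h b d = f b d by apply: (lfunE (fr b)).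
have h_lin : linear h.
  by move=> a b b'; apply/lfunP => d; rewrite add_lfunE scale_lfunE !hE f_linl.
pose hL : {linear V -> 'End(V)} := HB.pack h (GRing.isLinear.Build k V _ _ h h_lin).
by exists (linfun hL) => b d; rewrite lfunE /= hE.
Qed.

Lemma surjective_bijective (V W : vectType k) (f : V -> W) : linear f ->
  \dim {:V} = \dim {:W} -> (forall y, exists x, y = f x) -> bijective f.
Proof.
move=> f_lin dimVW f_surj.
pose fL : {linear V -> W} := HB.pack f (GRing.isLinear.Build k V W _ f f_lin).
pose h := linfun fL.
have hE d : h d = f d by apply: (lfunE fL).
have imh : limg h = fullv.
  apply/eqP; rewrite eqEsubv subvf /=; apply/subvP => y _.
  by have [x ->] := f_surj y; rewrite -hE memv_img ?memvf.
have kerh : lker h = 0%VS.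
  apply/eqP; rewrite -dimv_eq0; have := limg_ker_dim h fullv.
  rewrite capfv imh -dimVW => /eqP; rewrite -{2}[\dim {:V}]add0n eqn_add2r => /eqP ->.
  by [].
exists (h^-1)%VF => [x|y]; first by rewrite -hE lker0_lfunK // kerh.
by rewrite -hE limg_lfunVK // imh memvf.
Qed.

Lemma coord_neq0 (V : vectType k) (y : V) : y != 0 ->
  exists i, coord (vbasis {:V}) i y != 0.
Proof.
move=> y0; apply/existsP; apply: contraR y0; rewrite negb_exists => /forallP y0.
rewrite (coord_vbasis (memvf y)) big1 // => i _.
by have /negPn/eqP -> := y0 i; rewrite scale0r.
Qed.

Lemma tens_eq0r (V W : vectType k) (y : V) (z : W) : y != 0 -> tens y z = 0 -> z = 0.
Proof.
case/coord_neq0=> i yi yz0; rewrite (coord_vbasis (memvf z)) big1 // => j _.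
have /matrixP/(_ i j)/eqP := yz0; rewrite !mxE mulf_eq0 (negPf yi) => /eqP ->.
by rewrite scale0r.
Qed.

(** Comparing the coordinates of both tensors at an index where y does not
    vanish expresses every coordinate of z through that of y. *)
Lemma tens_commuting (V : vectType k) (y z : V) : y != 0 -> tens y z = tens z y ->
  exists a, z = a *: y.
Proof.
case/coord_neq0=> i yi yz.
pose a := (coord (vbasis {:V}) i y)^-1 * coord (vbasis {:V}) i z.
exists a; rewrite (coord_vbasis (memvf z)) [in RHS](coord_vbasis (memvf y)).
rewrite scaler_sumr; apply: eq_bigr => j _; rewrite scalerA.
have /matrixP/(_ i j) := yz; rewrite !mxE => yzij.
by rewrite /a -mulrA -yzij mulKf.
Qed.

End LinearAlgebra.

(** * Generation of algebras *)

Section Generation.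
Variables (k : fieldType) (C : falgType k) (I : Type) (e : I -> C).

(** Subspaces as predicates in Prop, so that statements with quantifiers can be
    proved by induction on generators without building a [{vspace V}] for them. *)
Definition linear_pred (V : lmodType k) (P : V -> Prop) :=
  forall (a : k) (x y : V), P x -> P y -> P (a *: x + y).

(** Generation as an induction principle: every element is a combination of words
    in the [e i], built by multiplication on the left, or on the right in
    [rgenerated]. *)
Definition lgenerated := forall P : C -> Prop,
  linear_pred P -> P 1 -> (forall i x, P x -> P (e i * x)) -> forall x, P x.

Definition rgenerated := forall P : C -> Prop,
  linear_pred P -> P 1 -> (forall i x, P x -> P (x * e i)) -> forall x, P x.

End Generation.

Section LinearPred.
Variables (k : fieldType) (V : lmodType k) (P : V -> Prop).
Hypotheses (lP : linear_pred P) (v0 : V) (Pv0 : P v0).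

Lemma linear_pred0 : P 0.
Proof. by have := lP (-1) Pv0 Pv0; rewrite scaleN1r addNr. Qed.

Lemma linear_predD x y : P x -> P y -> P (x + y).
Proof. by move=> Px Py; rewrite -[x]scale1r; apply: lP. Qed.

Lemma linear_predZ a x : P x -> P (a *: x).
Proof. by move=> Px; rewrite -[a *: x]addr0; apply: lP Px linear_pred0. Qed.

Lemma linear_predB x y : P x -> P y -> P (x - y).
Proof. by move=> Px Py; apply: linear_predD Px _; rewrite -scaleN1r; apply: linear_predZ. Qed.

Lemma linear_pred_sum (I : finType) (F : I -> V) :
  (forall i, P (F i)) -> P (\sum_i F i).
Proof.
by move=> PF; apply: (big_ind P) => //; [apply: linear_pred0 | apply: linear_predD].
Qed.

End LinearPred.

Section Agenv.
Variables (k : fieldType) (B : falgType k).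

(** Membership in a product of subspaces is defined by spanning vectors; this is
    the induction principle that goes with it. *)
Lemma prodv_ind (P : B -> Prop) (U V : {vspace B}) : linear_pred P -> P 0 ->
  {in U & V, forall x y, P (x * y)} -> forall x, x \in (U * V)%VS -> P x.
Proof.
move=> lP P0 PUV x; rewrite [@prodv _ _]unlock => /coord_span ->.
apply: (linear_pred_sum lP P0) => i; apply: (linear_predZ lP P0).
have /(mem_nth 0)/allpairsP[[y z] /= [/vbasis_mem Uy /vbasis_mem Vz ->]] :
  (i < size (allpairs *%R (vbasis U) (vbasis V)))%N.
  by rewrite size_allpairs !size_tuple.
exact: PUV.
Qed.

Variables (m : nat) (e : 'I_m -> B).
Hypothesis e_full : agenv <<codom e>>%VS = fullv.

Let agenv_ind (P : B -> Prop) : linear_pred P -> P 0 ->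
  (forall i x, x \in (<<codom e>> ^+ i)%VS -> P x) -> forall x, P x.
Proof.
move=> lP P0 Pexp x.
have: x \in agenv <<codom e>>%VS by rewrite e_full memvf.
rewrite /agenv => /memv_sumP[f f_in ->].
by apply: (linear_pred_sum lP P0) => i; apply: Pexp (f_in i isT).
Qed.

Let span_ind (P : B -> Prop) : linear_pred P -> P 0 -> (forall i, P (e i)) ->
  {in <<codom e>>%VS, forall x, P x}.
Proof.
move=> lP P0 Pe x /coord_span ->; apply: (linear_pred_sum lP P0) => i.
apply: (linear_predZ lP P0).
have /(mem_nth 0)/codomP[j ->] // : (i < size (codom e))%N by rewrite size_codom.
Qed.

Lemma agenv_lgenerated : lgenerated e.
Proof.
move=> P lP P1 Pe; have P0 := linear_pred0 lP P1; apply: agenv_ind => // i.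
elim: i => [|i IHi] x; first by rewrite expv0 => /vlineP[a ->]; apply: (linear_predZ lP P1).
rewrite expvSl; apply: prodv_ind => // y z + z_in.
move: y; apply: span_ind => [a y y' Py Py'||j].
- by rewrite mulrDl -scalerAl; apply: lP.
- by rewrite mul0r.
exact/Pe/IHi.
Qed.

Lemma agenv_rgenerated : rgenerated e.
Proof.
move=> P lP P1 Pe; have P0 := linear_pred0 lP P1; apply: agenv_ind => // i.
elim: i => [|i IHi] x; first by rewrite expv0 => /vlineP[a ->]; apply: (linear_predZ lP P1).
rewrite expvSr; apply: prodv_ind => // y z y_in.
move: z; apply: span_ind => [a z z' Pz Pz'||j].
- by rewrite mulrDr -scalerAr; apply: lP.
- by rewrite mulr0.
exact/Pe/IHi.
Qed.

End Agenv.

Section Presentation.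
Variables (k : fieldType) (n : nat).

(** The two kinds of generators as one family, so that the relations of Cl become
    one symmetric matrix with a block for u and a block for the v_i. *)
Definition gens (T : Type) (u : T) (v : 'I_n -> T) (i : 'I_(1 + n)) : T :=
  if split i is inr j then v j else u.

Lemma gens_head T (u : T) v i : gens u v (lshift n i) = u.
Proof. by rewrite /gens (unsplitK (inl i)). Qed.

Lemma gens_tail T (u : T) v j : gens u v (rshift 1 j) = v j.
Proof. by rewrite /gens (unsplitK (inr j)). Qed.

(** Initiality gives a map from B to the subalgebra S generated by u and v.
    Followed by the inclusion it is an endomorphism of B that fixes the generators,
    hence the identity, so S is all of B. *)
Lemma presented_full (rel : forall C : algType k, C -> ('I_n -> C) -> Prop)
    (B : falgType k) (u : B) (v : 'I_n -> B) :
    is_presented rel u v ->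
    (forall (S : {aspace B}) (u' : subvs_of S) (v' : 'I_n -> subvs_of S),
       1 \in S -> vsval u' = u -> (forall i, vsval (v' i) = v i) ->
       rel (subvs_of S) u' v') ->
  agenv <<codom (gens u v)>>%VS = fullv.
Proof.
move=> [relB init] rel_sub; set S := agenv _.
pose SA : {aspace B} := agenv_aspace <<codom (gens u v)>>%VS.
have S1 : 1 \in SA by rewrite memvE sub1_agenv.
have gen_in i : gens u v i \in SA.
  by apply: (subvP (sub_agenv _)); rewrite memv_span // codom_f.
have Su : u \in SA by have := gen_in (lshift n ord0); rewrite gens_head.
have Sv j : v j \in SA by have := gen_in (rshift 1 j); rewrite gens_tail.
have [|f [[fu fv] _]] :=
  init (subvs_of SA) (Subvs Su) (fun j => Subvs (Sv j)); first exact: rel_sub.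
have [f_id [_ uniq]] := init B u v relB.
pose h b := vsval (f b).
have h_lin : linear h by move=> a x y; rewrite /h !linearP.
have h_mon : monoid_morphism h.
  split=> [|x y]; rewrite /h.
    by rewrite rmorph1; apply/eqP; rewrite algid_eq1.
  by rewrite rmorphM.
pose hL : {lrmorphism B -> B} := HB.pack h
  (GRing.isLinear.Build k B B _ h h_lin) (GRing.isMonoidMorphism.Build B B h h_mon).
pose iL : {lrmorphism B -> B} := idfun.
apply/eqP; rewrite eqEsubv subvf /=; apply/subvP => b _.
have -> : b = hL b.
  have hu : hL u = u by rewrite /= /h fu.
  have hv i : hL (v i) = v i by rewrite /= /h fv.
  by rewrite (uniq hL hu hv) -(uniq iL).
exact: subvsP.
Qed.

End Presentation.

(** * Irreducibility of the Fock representation *)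

Section Fock.
Variables (k : fieldType) (two_neq0 : 2%:R != 0 :> k).
Variables (C : falgType k) (m : nat) (e : 'I_m -> C) (Q : 'M[k]_m).
Variable N : 'I_m -> 'End(C).
Hypothesis e_gen : lgenerated e.
Hypothesis eQ : forall i j, e i * e j + e j * e i = (Q i j)%:A.
Hypothesis N1 : forall i, N i 1 = 0.
Hypothesis Ne : forall i j d, N i (e j * d) = (i == j)%:R *: d - e j * N i d.

(** N_i N_j + N_j N_i kills 1 and commutes with the left multiplications by
    generators. *)
Lemma contraction_anticomm i j d : N i (N j d) = - N j (N i d).
Proof.
move: d; apply: e_gen => [a x y ex ey||l x ex].
- by rewrite !(linearP (N j)) !(linearP (N i)) !(linearP (N j)) /= ex ey scalerN opprD.
- by rewrite !N1 (linear0 (N i)) (linear0 (N j)) oppr0.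
rewrite !Ne !linearB !linearZ /= !Ne ex mulrN.
by rewrite !opprK scalerN opprD addrA addrA [X in X - _]addrC.
Qed.

Lemma contraction_sq0 i d : N i (N i d) = 0.
Proof.
have /eqP := contraction_anticomm i i d.
by rewrite -addr_eq0 -mulr2n -scaler_nat scaler_eq0 (negPf two_neq0) => /eqP.
Qed.

(** The contraction by the i-th row of the form. *)
Let hop i : 'End(C) := \sum_l Q i l *: N l.

Let hopE i d : hop i d = \sum_l Q i l *: N l d.
Proof.
by rewrite sum_lfunE; apply: eq_bigr => l _; rewrite scale_lfunE.
Qed.

Let hop_hop i j d : hop i (hop j d) = - hop j (hop i d).
Proof.
rewrite !hopE.
under eq_bigr => l _ do rewrite linear_sum scaler_sumr.
under [in RHS]eq_bigr => l _ do rewrite linear_sum scaler_sumr.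
rewrite exchange_big -sumrN; apply: eq_bigr => l _.
rewrite -sumrN; apply: eq_bigr => l' _.
by rewrite !linearZ /= !scalerA mulrC contraction_anticomm scalerN.
Qed.

(** The left multiplications by the [e i] only satisfy Clifford relations.
    Subtracting half of the contraction by the form turns them into operators
    with vanishing anticommutators, with the same relations to the [N j]. *)
Definition creation i : 'End(C) := amull (e i) - 2^-1 *: hop i.

Lemma creationE i d : creation i d = e i * d - 2^-1 *: hop i d.
Proof. by rewrite add_lfunE opp_lfunE scale_lfunE lfunE. Qed.

Lemma contraction_creation i j d :
  N i (creation j d) = (i == j)%:R *: d - creation j (N i d).
Proof.
rewrite !creationE linearB linearZ /= Ne opprB -!addrA; congr (_ + _).
rewrite [RHS]addrC; congr (_ + _); rewrite -scalerN; congr (_ *: _).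
rewrite !hopE linear_sum -sumrN; apply: eq_bigr => l _.
by rewrite linearZ /= contraction_anticomm scalerN.
Qed.

Let hop_creation i j d : hop i (creation j d) = Q i j *: d - creation j (hop i d).
Proof.
rewrite !hopE.
under eq_bigr => l _ do rewrite contraction_creation scalerBr scalerA.
rewrite sumrB (bigD1 j) //= eqxx mulr1 big1 ?addr0; last first.
  by move=> l /negPf lj; rewrite lj mulr0 scale0r.
congr (_ - _); rewrite linear_sum; apply: eq_bigr => l _.
by rewrite linearZ.
Qed.

Let Q_sym i j : Q i j = Q j i.
Proof.
apply/eqP; rewrite -subr_eq0; apply/eqP.
have /eqP := eQ i j; rewrite addrC eQ -subr_eq0 -scalerBl scaler_eq0 oner_eq0.
by rewrite orbF => /eqP/(congr1 -%R); rewrite opprB oppr0.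
Qed.

(** The anticommutator of two left multiplications is Q_ij; each of the two
    mixed anticommutators removes half of it. *)
Lemma creation_anticomm i j d : creation i (creation j d) = - creation j (creation i d).
Proof.
apply/eqP; rewrite -addr_eq0; apply/eqP.
have half l l' : creation l (creation l' d) =
    e l * creation l' d + 2^-1 *: creation l' (hop l d) - 2^-1 *: (Q l l' *: d).
  by rewrite creationE hop_creation scalerBr opprB addrA.
have pair l l' : e l * creation l' d + 2^-1 *: creation l (hop l' d) =
    e l * (e l' * d) - (2^-1 * 2^-1) *: hop l (hop l' d).
  rewrite !creationE mulrBr -scalerAr scalerBr scalerA addrA.
  by rewrite -[_ - _ + _]addrA addNr addr0.
rewrite !half (Q_sym j i) addrACA -opprD [e j * _ + _]addrC.
rewrite [X in X - _]addrACA [2^-1 *: creation j (hop i d) + _]addrC.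
rewrite !pair [X in X - _]addrACA -opprD -scalerDr.
rewrite [hop i (hop j d)]hop_hop addNr scaler0 subr0 !mulrA -mulrDl eQ.
by rewrite -scalerAl mul1r -mulr2n -scaler_nat scalerA mulfV // scale1r subrr.
Qed.

Lemma creation_sq0 i d : creation i (creation i d) = 0.
Proof.
have /eqP := creation_anticomm i i d.
by rewrite -addr_eq0 -mulr2n -scaler_nat scaler_eq0 (negPf two_neq0) => /eqP.
Qed.

(** The set of combinations of words in the creation operators applied to 1 is
    stable under the [N l], hence also under left multiplication by
    [e i] = [creation i] + [hop i] / 2. *)
Lemma creation_lgenerated (P : C -> Prop) :
  linear_pred P -> P 1 -> (forall i x, P x -> P (creation i x)) -> forall x, P x.
Proof.
move=> lP P1 Pa.
(* The smallest subspace that contains 1 and is stable under the creation operators. *)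
pose S x := forall P' : C -> Prop, linear_pred P' -> P' 1 ->
  (forall i y, P' y -> P' (creation i y)) -> P' x.
suff S_all x : S x by move=> x; apply: S_all.
have S1 : S 1 by move=> P' _.
have lS : linear_pred S.
  by move=> a y z Sy Sz P' lP' P'1 P'a; apply: (lP'); [apply: Sy|apply: Sz].
have Sa i y : S y -> S (creation i y).
  by move=> Sy P' lP' P'1 P'a; apply: (P'a); apply: Sy.
have SN l y : S y -> S (N l y).
  move=> Sy; suff [] : S y /\ S (N l y) by [].
  apply: (Sy (fun y => S y /\ S (N l y))).
  - by move=> a z t [Sz Sz'] [St St']; rewrite linearP; split; apply: lS.
  - by rewrite N1; split => //; apply: linear_pred0 S1.
  move=> i z [Sz Sz']; split; first exact: Sa.
  rewrite contraction_creation.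
  by apply: (linear_predB lS S1); [apply: (linear_predZ lS S1)|apply: Sa].
move: x; apply: e_gen => // i y Sy.
have -> : e i * y = creation i y + 2^-1 *: hop i y by rewrite creationE subrK.
apply: (linear_predD lS); first exact: Sa.
apply: (linear_predZ lS S1); rewrite hopE; apply: (linear_pred_sum lS S1) => l.
by apply: (linear_predZ lS S1); apply: SN.
Qed.

(** For s an enumeration of all indices this is the projection onto the vacuum
    line k 1: the product of the commuting idempotents N_i a_i, with a_i the
    creation operators. *)
Let vac (s : seq 'I_m) : 'End(C) :=
  foldr (fun i X => X \o (N i \o creation i))%VF \1%VF s.

Let vac_cons i s d : vac (i :: s) d = vac s (N i (creation i d)).
Proof. by rewrite /= !comp_lfunE. Qed.

Let number_creation i j d : i != j ->
  N i (creation i (creation j d)) = creation j (N i (creation i d)).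
Proof.
move=> /negPf ij.
by rewrite creation_anticomm linearN /= (contraction_creation i j) ij scale0r sub0r opprK.
Qed.

Let vac_creation s i d : i \notin s -> vac s (creation i d) = creation i (vac s d).
Proof.
elim: s d => [|j s IHs] d; first by rewrite !id_lfunE.
rewrite inE negb_or => /andP[ij nis].
by rewrite !vac_cons number_creation 1?eq_sym // IHs.
Qed.

Let vac_creation0 s i d : i \in s -> vac s (creation i d) = 0.
Proof.
elim: s d => [|j s IHs] d; first by [].
rewrite inE vac_cons; case: (eqVneq i j) => [->|ij] /= s_i.
  by rewrite creation_sq0 !linear0.
by rewrite number_creation 1?eq_sym // IHs.
Qed.

Let vac1 s : vac s 1 = 1.
Proof.
elim: s => [|i s IHs]; first by rewrite id_lfunE.
by rewrite vac_cons contraction_creation N1 linear0 eqxx scale1r subr0.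
Qed.

Let vac_scalar d : exists a, vac (enum 'I_m) d = a%:A.
Proof.
move: d; apply: creation_lgenerated => [b x y [ax Ex] [ay Ey]||i x _].
- by exists (b * ax + ay); rewrite linearP /= Ex Ey scalerDl scalerA.
- by exists 1; rewrite vac1 scale1r.
- by exists 0; rewrite vac_creation0 ?mem_enum // scale0r.
Qed.

Variable A : 'End(C) -> Prop.
Hypothesis A_linear : linear_pred A.
Hypothesis A_id : A \1%VF.
Hypothesis A_comp : forall X Y, A X -> A Y -> A (X \o Y)%VF.
Hypothesis A_mul : forall a, A (amull a).
Hypothesis A_contraction : forall i, A (N i).

Let A_creation i : A (creation i).
Proof.
apply: (linear_predB A_linear A_id); first exact: A_mul.
apply/(linear_predZ A_linear A_id)/(linear_pred_sum A_linear A_id) => l.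
exact/(linear_predZ A_linear A_id).
Qed.

Let A_vac s : A (vac s).
Proof. by elim: s => //= i s IHs; apply/A_comp/A_comp. Qed.

(** An algebra A of operators that contains the left multiplications and the [N i]
    contains the vacuum projection p, and X p = L_(X 1) p lies in A for every X. The
    factors N_i a_i of p are then removed one at a time, as
    1 = N_i a_i + a_i N_i: if Y Z N_i a_i is in A for all Y and Z commutes with a_i, then
    X Z = X Z N_i a_i + (X a_i) (Z N_i a_i) N_i is in A, because a_i N_i = a_i N_i a_i N_i. *)
Lemma fock_irreducible X : A X.
Proof.
suff all_vac s : uniq s -> (forall Y, A (Y \o vac s)%VF) -> A X.
  apply: (all_vac (enum 'I_m)); rewrite ?enum_uniq // => Y.
  suff -> : (Y \o vac (enum 'I_m) = amull (Y 1) \o vac (enum 'I_m))%VF.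
    exact: A_comp.
  apply/lfunP => d; rewrite !comp_lfunE lfunE /=; have [a ->] := vac_scalar d.
  by rewrite linearZ /= -scalerAr mulr1.
elim: s => [_ Avac|i s IHs /andP[nis us] Avac].
  by have := Avac X; rewrite comp_lfun1r.
apply: IHs => // Y.
suff -> : (Y \o vac s = Y \o vac (i :: s)
    + (((Y \o creation i) \o vac (i :: s)) \o N i))%VF.
  by apply: (linear_predD A_linear) => //; apply: A_comp.
apply/lfunP => d; rewrite add_lfunE !comp_lfunE -linearD -vac_creation // -linearD.
congr (Y (vac s _)).
have split x : x = N i (creation i x) + creation i (N i x).
  by rewrite contraction_creation eqxx scale1r subrK.
rewrite {1}[d]split; congr (_ + _).
by rewrite {1}[N i d]split contraction_sq0 linear0 addr0.
Qed.

End Fock.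

(** * Braided multiplications of an algebra with skew derivations *)

Section SkewDerivation.
Variables (k : fieldType) (C : falgType k) (g : 'End(C)).

(** The left form of the Leibniz rule; the right form is this one in the converse
    algebra. *)
Definition skew_derivation (D : 'End(C)) :=
  forall x y, D (x * y) = g x * D y + D x * y.

Hypotheses (g1 : g 1 = 1) (gM : forall x y, g (x * y) = g x * g y).

Lemma skew_derivation1 D : skew_derivation D -> D 1 = 0.
Proof.
move=> DM; apply/eqP.
by have /eqP := DM 1 1; rewrite mulr1 g1 mul1r mulr1 -subr_eq subrr eq_sym.
Qed.

Variables (I : Type) (e : I -> C).
Hypotheses (e_gen : rgenerated e) (ge : forall i, g (e i) = - e i).

Lemma grading_involutive d : g (g d) = d.
Proof.
move: d; apply: e_gen => [a x y Ex Ey||i x Ex].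
- by rewrite !linearP /= Ex Ey.
- by rewrite !g1.
by rewrite !gM Ex !ge linearN /= ge opprK.
Qed.

(** D g + g D kills 1 and commutes, up to sign, with right multiplication by
    generators. *)
Lemma skew_derivation_grading D (w : I -> k) : skew_derivation D ->
  (forall i, D (e i) = (w i)%:A) -> forall d, D (g d) = - g (D d).
Proof.
move=> DM De; apply: e_gen => [a x y Ex Ey||i x Ex].
- by rewrite !(linearP g) !(linearP D) !(linearP g) /= Ex Ey opprD scalerN.
- by rewrite g1 (skew_derivation1 DM) linear0 oppr0.
rewrite gM ge !mulrN linearN /= !DM De Ex (linearD g) /= !gM ge (linearZZ g) /= g1.
by rewrite !mulrN mulNr.
Qed.

Lemma skew_derivation_anticomm D D' (w w' : I -> k) :
    skew_derivation D -> (forall i, D (e i) = (w i)%:A) ->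
    skew_derivation D' -> (forall i, D' (e i) = (w' i)%:A) ->
  forall d, D (D' d) = - D' (D d).
Proof.
move=> DM De D'M D'e; apply: e_gen => [a x y Ex Ey||i x Ex].
- by rewrite !(linearP D') !(linearP D) !(linearP D') /= Ex Ey opprD scalerN.
- by rewrite (skew_derivation1 DM) (skew_derivation1 D'M) (linear0 D) (linear0 D') oppr0.
rewrite !(DM, D'M) !De !D'e -!scalerAr !mulr1 !linearD !linearZ /= !(DM, D'M).
rewrite De D'e (skew_derivation_grading DM De) (skew_derivation_grading D'M D'e).
rewrite -!scalerAr !mulr1 !opprD !scalerN Ex mulNr !opprK addrA addrA.
by congr (_ - _); rewrite [RHS]addrC.
Qed.

End SkewDerivation.

Section BraidedMultiplications.
Variables (k : fieldType) (two_neq0 : 2%:R != 0 :> k).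
Variables (C : falgType k) (m : nat) (e : 'I_m -> C) (Q W : 'M[k]_m).
Variables (g : 'End(C)) (D : 'I_m -> 'End(C)) (R : 'Hom(C, 'End(C))).
Hypothesis e_lgen : lgenerated e.
Hypothesis e_rgen : rgenerated e.
Hypothesis eQ : forall i j, e i * e j + e j * e i = (Q i j)%:A.
Hypotheses (g1 : g 1 = 1) (gM : forall x y, g (x * y) = g x * g y).
Hypothesis ge : forall i, g (e i) = - e i.
Hypothesis DM : forall j, skew_derivation g (D j).
Hypothesis De : forall i j, D j (e i) = (W i j)%:A.
Hypothesis R1 : forall d, R 1 d = d.
Hypothesis Re : forall b j d, R (b * e j) d = R b (D j d) + R b (g d) * e j.

Let gg := grading_involutive g1 gM e_rgen ge.

Let Dg j d : D j (g d) = - g (D j d).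
Proof. exact: (skew_derivation_grading g1 gM e_rgen ge (DM j) (De^~ j)). Qed.

Let DD i j d : D i (D j d) = - D j (D i d).
Proof.
exact: (skew_derivation_anticomm g1 gM e_rgen ge (DM i) (De^~ i) (DM j) (De^~ j)).
Qed.

Lemma R_grading b d : g (R b d) = R (g b) (g d).
Proof.
move: b d; apply: e_rgen => [a x y Ex Ey d|d|i x Ex d].
- by rewrite !linearP !add_lfunE !scale_lfunE linearP /= Ex Ey.
- by rewrite g1 !R1.
rewrite Re linearD gM ge mulrN linearN /= opp_lfunE Re gM ge mulrN !Ex Dg.
by rewrite linearN /= opprD opprK.
Qed.

(** The braided multiplication intertwines D_j on its operand and on the element
    multiplied by. Together with [R_grading] this shows that the span of the
    L_a R_b is stable under left composition with the R_(e_j), as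
    R_(e_j) R_b = R_(g(b) e_j) + R_(D_j(b)). *)
Lemma R_derivation j b d : D j (R b d) = R (g b) (D j d) + R (D j b) d.
Proof.
move: b d; apply: e_rgen => [a x y Ex Ey d|d|i x Ex d].
- rewrite !linearP !add_lfunE !scale_lfunE linearP /= Ex Ey.
  by rewrite scalerDr addrACA.
- by rewrite g1 (skew_derivation1 g1 (DM j)) linear0 !R1 zero_lfunE addr0.
rewrite Re (linearD (D j)) /= !DM De !Ex gM ge mulrN.
rewrite R_grading gg DD Dg (linearN R) (linearD R) opp_lfunE add_lfunE !Re.
rewrite -!scalerAr !mulr1 (linearZZ R) scale_lfunE !(linearN (R _)) /=.
rewrite mulrDl mulNr !addrA opprD; congr (_ + _).
rewrite -!addrA; congr (_ + _); rewrite addrCA [RHS]addrCA; congr (_ + _).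
by rewrite addrC.
Qed.

(** Membership in the span of the L_a R_b, the image of the first Azumaya map. *)
Definition in_image (X : 'End(C)) :=
  exists t : tprod C C, X = tsum t (fun a b => amull a \o R b)%VF.

Let in_image_linear : linear_pred in_image.
Proof. by move=> a _ _ [t ->] [s ->]; exists (a *: t + s); rewrite tsum_is_linear. Qed.

Let in_image_mul a b : in_image (amull a \o R b)%VF.
Proof.
exists (tens a b); rewrite tsum_tens // => [b' c x y|a' c x y] /=.
  by rewrite linearP comp_lfunDl comp_lfunZl.
by rewrite linearP comp_lfunDr comp_lfunZr.
Qed.

Let in_image_id : in_image \1%VF.
Proof.
suff <- : (amull 1 \o R 1 = \1)%VF by exact: in_image_mul.
by apply/lfunP => d; rewrite comp_lfunE lfunE /= R1 mul1r id_lfunE.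
Qed.

Let in_image_tsum t (F : C -> C -> 'End(C)) :
  (forall a b, in_image (F a b)) -> in_image (tsum t F).
Proof.
move=> F_in; apply: (linear_pred_sum in_image_linear in_image_id) => i.
apply: (linear_pred_sum in_image_linear in_image_id) => j.
exact: (linear_predZ in_image_linear in_image_id).
Qed.

(** Stability under composition is clear for this set, though not for [in_image].
    It lies in [in_image], as the identity does. *)
Let acts X := forall Y, in_image Y -> in_image (X \o Y)%VF.

Let actsP X : (forall a b, in_image (X \o (amull a \o R b))%VF) -> acts X.
Proof.
move=> X_in _ [t ->]; rewrite (linear_tsum (h := fun Y => (X \o Y)%VF)) //.
  exact: in_image_tsum.
by move=> a Y Z; rewrite comp_lfunDr comp_lfunZr.
Qed.

Let acts_mul a : acts (amull a).
Proof.
apply: actsP => a' b; suff -> : (amull a \o (amull a' \o R b) =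
  amull (a * a') \o R b)%VF by exact: in_image_mul.
by apply/lfunP => d; rewrite !comp_lfunE !lfunE /= mulrA.
Qed.

Let acts_R j : acts (R (e j)).
Proof.
have R_e d : R (e j) d = D j d + g d * e j by rewrite -[e j]mul1r Re !R1 mul1r.
apply: actsP => a b; suff -> : (R (e j) \o (amull a \o R b) =
    (amull (g a) \o R (g b * e j)) + ((amull (g a) \o R (D j b))
    + (amull (D j a) \o R b)))%VF.
  by do 2!apply: (linear_predD in_image_linear) => //.
apply/lfunP => d; rewrite !add_lfunE !comp_lfunE !lfunE /= R_e DM gM.
rewrite R_grading R_derivation Re !mulrDr -!mulrA -!addrA; congr (_ + _).
by rewrite [RHS]addrC -addrA.
Qed.

(** Right and left multiplication by a generator agree at 1; their difference
    kills the vacuum. *)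
Definition annihilation j : 'End(C) := R (e j) - amull (e j).

Lemma annihilationE j d : annihilation j d = D j d + g d * e j - e j * d.
Proof. by rewrite add_lfunE opp_lfunE lfunE /= -{1}[e j]mul1r Re !R1. Qed.

Lemma annihilation1 j : annihilation j 1 = 0.
Proof. by rewrite annihilationE (skew_derivation1 g1 (DM j)) g1 mul1r mulr1 add0r subrr. Qed.

Lemma annihilation_e j i d :
  annihilation j (e i * d) = (W i j - Q i j) *: d - e i * annihilation j d.
Proof.
rewrite !annihilationE DM De gM ge mulrBr mulrDr scalerBl -scalerAl mul1r.
have -> : Q i j *: d = e i * (e j * d) + e j * (e i * d).
  by rewrite !mulrA -mulrDl eQ -scalerAl mul1r.
rewrite !mulNr !opprD opprK !mulrA -!addrA addrCA; congr (_ + _).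
by rewrite [RHS]addrC !addrA addrK -[RHS]addrA [RHS]addrC.
Qed.

(** Such a combination anticommutes with the left multiplications by generators and
    kills 1. *)
Lemma annihilation_singular (w : 'I_m -> k) :
  (forall i, \sum_j w j * (W i j - Q i j) = 0) ->
  \sum_j w j *: annihilation j = 0.
Proof.
move=> w0; apply/lfunP; apply: e_lgen => [a x y Ex Ey||i d Ed].
- by rewrite linearP /= Ex Ey !zero_lfunE scaler0 addr0.
- by rewrite sum_lfunE zero_lfunE big1 // => j _; rewrite scale_lfunE annihilation1 scaler0.
rewrite zero_lfunE sum_lfunE.
under eq_bigr => j _ do rewrite scale_lfunE annihilation_e scalerBr scalerA.
rewrite sumrB -scaler_suml w0 scale0r sub0r.
under eq_bigr => j _ do rewrite scalerAr -scale_lfunE.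
by rewrite -mulr_sumr -sum_lfunE Ed zero_lfunE mulr0 oppr0.
Qed.

Lemma multiplications_span : W - Q \in unitmx -> forall X, in_image X.
Proof.
move=> WQ_unit X; pose K := invmx (W - Q).
pose N i : 'End(C) := \sum_l K l i *: annihilation l.
have NE i d : N i d = \sum_l K l i *: annihilation l d.
  by rewrite sum_lfunE; apply: eq_bigr => l _; rewrite scale_lfunE.
have N1 i : N i 1 = 0.
  by rewrite NE big1 // => l _; rewrite annihilation1 scaler0.
have Ne i j d : N i (e j * d) = (i == j)%:R *: d - e j * N i d.
  rewrite !NE; under eq_bigr => l _ do rewrite annihilation_e scalerBr scalerA.
  rewrite sumrB -scaler_suml mulr_sumr; congr (_ *: _ - _).
    have /matrixP/(_ j i) := mulmxV WQ_unit; rewrite !mxE eq_sym => <-.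
    by apply: eq_bigr => l _; rewrite !mxE mulrC.
  by apply: eq_bigr => l _; rewrite scalerAr.
have acts_linear : linear_pred acts.
  move=> a Y Z acY acZ T T_in; rewrite comp_lfunDl -comp_lfunZl.
  by apply: in_image_linear; [apply: acY|apply: acZ].
have acts_id : acts \1%VF by move=> Y; rewrite comp_lfun1l.
suff /(_ _ in_image_id) : acts X by rewrite comp_lfun1r.
apply: (fock_irreducible (A := acts) two_neq0 e_lgen eQ N1 Ne acts_linear acts_id
  _ acts_mul) => [Y Z acY acZ T T_in|i].
  by rewrite -comp_lfunA; apply/acY/acZ.
apply: (linear_pred_sum acts_linear acts_id) => l.
apply: (linear_predZ acts_linear acts_id).
by apply: (linear_predB acts_linear acts_id).
Qed.

End BraidedMultiplications.

(** * Action of the dual on a comodule algebra *)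

Section DualAction.
Variables (k : fieldType) (H : hopfAlgebra k) (M : falgType k).
Variable rho : 'Hom(M, tprod M H).
Implicit Types phi psi : 'Hom(H, k^o).

(** The right coaction of H makes M a module over the dual of H with convolution:
    phi sends d to the sum of the d_0 phi(d_1). *)
Definition dual_act phi : 'End(M) :=
  linfun (fun d => tsum (rho d) (fun d0 d1 => phi d1 *: d0)).

Lemma dual_actE phi (d : M) :
  dual_act phi d = tsum (rho d) (fun d0 d1 => phi d1 *: d0).
Proof.
pose h d := tsum (rho d) (fun d0 d1 => (phi d1 : k) *: d0).
have h_lin : linear h by move=> a x y; rewrite /h linearP tsum_is_linear.
pose hL : {linear M -> M} := HB.pack h (GRing.isLinear.Build k M M _ h h_lin).
exact: (lfunE hL).
Qed.

Let scale_linl phi (d1 : H) : linear (fun d0 : M => (phi d1 : k) *: d0).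
Proof. by move=> a x y; rewrite scalerDr !scalerA mulrC. Qed.

Let scale_linr phi (d0 : M) : linear (fun d1 : H => (phi d1 : k) *: d0).
Proof. by move=> a x y; rewrite linearP scalerDl scalerA. Qed.

Lemma tsum_scale phi (a : M) (h : H) :
  tsum (tens a h) (fun (d0 : M) (d1 : H) => (phi d1 : k) *: d0) = (phi h : k) *: a.
Proof. by rewrite tsum_tens. Qed.

Lemma dual_act_tens phi (d a : M) (b : H) :
  rho d = tens a b -> dual_act phi d = (phi b : k) *: a.
Proof. by rewrite dual_actE => ->; rewrite tsum_scale. Qed.

Lemma dual_act_skew_primitive phi (d : M) (y c : H) : rho d = tens 1 y + tens d c ->
  dual_act phi d = (phi y : k)%:A + (phi c : k) *: d.
Proof. by rewrite dual_actE => ->; rewrite tsumD !tsum_scale. Qed.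

(** Coassociativity: acting on the comodule M is acting on the second factor of
    the coaction, through the regular comodule H. *)
Lemma dual_act_coact phi (d : M) : is_comodule rho ->
  rho (dual_act phi d) = tsum (rho d) (fun d0 d1 =>
    tens d0 (tsum (comul d1) (fun d11 d12 => (phi d12 : k) *: d11))).
Proof.
case=> coassoc _.
have := congr1 (fun t => tsum t (fun s h => (phi h : k) *: s)) (coassoc d).
rewrite tsum_tsum_tens; first last.
- by move=> s a h h'; rewrite linearP scalerDl scalerA.
- by move=> h a s s'; rewrite scalerDr !scalerA mulrC.
rewrite (linear_tsum _ _ (tsum_is_linear _)) dual_actE.
rewrite (linear_tsum (h := rho)); last by move=> a x y; rewrite linearP.
move=> coact_phi.
rewrite (eq_tsum _ (f' := fun d0 d1 => (phi d1 : k) *: rho d0)); last first.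
  by move=> d0 d1; rewrite linearZ.
rewrite coact_phi; apply: eq_tsum => d0 d1.
rewrite tsum_tsum_tens; first last.
- by move=> s a h h'; rewrite linearP scalerDl scalerA.
- by move=> h a s s'; rewrite scalerDr !scalerA mulrC.
rewrite (linear_tsum (h := tens d0)); last exact: tens_linr.
apply: eq_tsum => d11 d12.
by apply/matrixP => i j; rewrite !mxE linearZ /= mulrCA.
Qed.

(** The hypothesis on phi is the coproduct of phi in the dual Hopf algebra, with two
    terms. *)
Lemma dual_act_mul phi phi1 psi1 phi2 psi2 (a b : M) : is_comodule_algebra rho ->
    (forall h h', (phi (h * h') : k) = phi1 h * psi1 h' + phi2 h * psi2 h') ->
  dual_act phi (a * b) =
    dual_act phi1 a * dual_act psi1 b + dual_act phi2 a * dual_act psi2 b.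
Proof.
case=> _ _ rhoM phiM; rewrite !dual_actE rhoM.
rewrite (linear_tsum _ _ (tsum_is_linear _)).
have mul_tsum (f h : 'Hom(H, k^o)) :
    tsum (rho a) (fun a0 a1 => tsum (rho b) (fun b0 b1 =>
       (f a1 * h b1 : k) *: (a0 * b0))) =
    tsum (rho a) (fun a0 a1 => (f a1 : k) *: a0)
      * tsum (rho b) (fun b0 b1 => (h b1 : k) *: b0).
  rewrite (linear_tsum (h := fun y => y * tsum (rho b) _)); last first.
    by move=> z y y'; rewrite mulrDl scalerAl.
  apply: eq_tsum => a0 a1.
  rewrite (linear_tsum (h := fun y => _ * y)); last first.
    by move=> z y y'; rewrite mulrDr scalerAr.
  by apply: eq_tsum => b0 b1; rewrite -scalerAl -scalerAr scalerA.
rewrite -!mul_tsum -tsumDr; apply: eq_tsum => a0 a1.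
rewrite (linear_tsum _ _ (tsum_is_linear _)) -tsumDr.
by apply: eq_tsum => b0 b1; rewrite tsum_scale phiM scalerDl.
Qed.

End DualAction.

Lemma op_comodule_algebra (k : fieldType) (H : hopfAlgebra k) (M : falgType k)
    (rho : 'Hom(M, tprod M H)) :
  is_comodule_algebra rho -> is_op_comodule_algebra (A := M^c) rho.
Proof.
case=> comod rho1 rhoM; split=> // a b.
by rewrite [LHS](rhoM b a) exchange_tsum.
Qed.

Lemma comul_comodule (k : fieldType) (H : hopfAlgebra k) :
  is_comodule_algebra (comul (h := H)).
Proof.
split; first (by split; [exact: comulA|exact: counitr]); first exact: comul1.
exact: comulM.
Qed.

(** * Skew functionals on E(n) and their action *)

Section En.
Variables (k : fieldType) (two_neq0 : 2%:R != 0 :> k) (n : nat).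
Variables (E : hopfAlgebra k) (c : E) (x : 'I_n -> E) (E_is_En : is_En c x).

Let presE : is_presented (@En_rel k n) c x. Proof. by case: E_is_En. Qed.

Let relE : En_rel c x. Proof. by case: presE. Qed.
Let c2 : c * c = 1. Proof. by case: relE => <-. Qed.
Let cx i : c * x i = - (x i * c).
Proof. by case: relE => _ /(_ i)/eqP; rewrite addr_eq0 => /eqP. Qed.
Let xx i j : x i * x j = - (x j * x i).
Proof. by case: relE => _ _ /(_ i j)/eqP; rewrite addr_eq0 => /eqP. Qed.
Let x2 i : x i * x i = 0. Proof. by case: relE => _ _ _ /(_ i). Qed.

Lemma En_full : agenv <<codom (gens c x)>>%VS = fullv.
Proof.
apply: (presented_full presE) => S u v S1 Eu Ev.
have S1' : algid S = 1 by apply/eqP; rewrite algid_eq1.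
split=> [|i|i j|i]; apply: val_inj; rewrite /= ?S1' ?Eu ?Ev.
- exact: c2.
- by rewrite cx addNr.
- by rewrite xx addNr.
- exact: x2.
Qed.

Lemma En_lgenerated (P : E -> Prop) : linear_pred P -> P 1 ->
  (forall h, P h -> P (c * h)) -> (forall i h, P h -> P (x i * h)) -> forall h, P h.
Proof.
move=> lP P1 Pc Px; apply: (agenv_lgenerated En_full) => // i h Ph.
by rewrite /gens; case: (split i) => j; [apply: Pc|apply: Px].
Qed.

(** An algebra map to k; for s = 1 the counit, for s = - 1 the parity character. *)
Definition is_character (chi : 'Hom(E, k^o)) (s : k) :=
  [/\ chi 1 = 1, forall h h', chi (h * h') = chi h * chi h', chi c = s
    & forall i, chi (x i) = 0].

Lemma counit_character : is_character counit 1.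
Proof. by case: E_is_En => _ _ [cc cx'] _; split=> //; [exact: counit1|exact: counitM]. Qed.

Lemma sign_character : exists gam, is_character gam (- 1).
Proof.
have [|f [[fc fx] _]] := presE.2 (k^o : algType k) (- 1) (fun=> 0).
  by split=> *; rewrite ?sqrrN ?expr1n ?(mulr0, mul0r, addr0, expr0n).
exists (linfun f); split=> [|h h'||i]; rewrite !lfunE //=.
- by rewrite rmorph1.
- by rewrite rmorphM.
Qed.

(** The functionals that are (chi, psi)-primitive in the dual Hopf algebra,
    normalized to vanish at c. *)
Definition is_skew_functional (chi psi : 'Hom(E, k^o)) (w : 'I_n -> k)
    (phi : 'Hom(E, k^o)) :=
  [/\ forall h h', phi (h * h') = phi h * psi h' + chi h * phi h',
      phi 1 = 0, phi c = 0 & forall i, phi (x i) = w i].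

(** A two-dimensional representation of E(n) by upper triangular matrices with
    diagonal (chi, psi) exists by the presentation: c acts by diag(s, - s) and x_i
    by w_i times the elementary nilpotent matrix. The upper right entry is the
    functional. *)
Lemma skew_functional chi psi s (w : 'I_n -> k) :
    s * s = 1 -> is_character chi s -> is_character psi (- s) ->
  exists phi, is_skew_functional chi psi w phi.
Proof.
move=> ss [chi1 chiM chic chix] [psi1 psiM psic psix].
(* cm is diag(s, - s); it anticommutes with the nilpotent matrices xm i. *)
pose cm : 'M[k]_2 := \matrix_(i, j) (if i == j then (-1) ^+ i * s else 0).
pose xm i : 'M[k]_2 := w i *: delta_mx 0 1.
have cmcm : cm * cm = 1.
  apply/matrixP => i j; rewrite !mxE !big_ord_recl big_ord0 !mxE.
  by case: i => [[|[|]]] //= ?; case: j => [[|[|]]] //= ?;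
    rewrite ?(mulr0, mul0r, addr0, add0r, expr0, expr1, mul1r, mulN1r, mulrNN).
have cmxm i : cm * xm i = s *: xm i.
  apply/matrixP => a b; rewrite !mxE !big_ord_recl big_ord0 !mxE.
  by case: a => [[|[|]]] //= ?; case: b => [[|[|]]] //= ?; ring.
have xmcm i : xm i * cm = - (s *: xm i).
  apply/matrixP => a b; rewrite !mxE !big_ord_recl big_ord0 !mxE.
  by case: a => [[|[|]]] //= ?; case: b => [[|[|]]] //= ?; ring.
have xmxm i j : xm i * xm j = 0.
  by rewrite -scalerAl -scalerAr -mulmxE mul_delta_mx_cond /= mulr0n !scaler0.
have [|f [[fc fx] _]] := presE.2 'M[k]_2 cm xm.
  split=> [|i|i j|i]; first by rewrite expr2.
  - by rewrite cmxm xmcm subrr.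
  - by rewrite !xmxm addr0.
  - by rewrite expr2 xmxm.
have mul2 (a b : 'M[k]_2) i j : (a * b) i j = a i 0 * b 0 j + a i 1 * b 1 j.
  rewrite mxE !big_ord_recl big_ord0 addr0.
  by rewrite (_ : lift ord0 ord0 = 1) //; apply: val_inj.
have f_tri h : [/\ f h 1 0 = 0, f h 0 0 = chi h & f h 1 1 = psi h].
  move: h; apply: En_lgenerated
    => [a h h' [f1 f2 f3] [f1' f2' f3']||h [f1 f2 f3]|i h [f1 f2 f3]].
  - by rewrite !linearP !mxE f1 f2 f3 f1' f2' f3' mulr0 addr0.
  - by rewrite rmorph1 !mxE chi1 psi1.
  - rewrite rmorphM /= fc chiM psiM chic psic !mul2 f1 f2 f3 !mxE /=.
    by split; ring.
  rewrite rmorphM /= fx chiM psiM chix psix !mul2 f1 f3 !mxE /=.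
  by split; ring.
have phi_lin : linear (fun h => f h 0 1 : k^o).
  by move=> a h h'; rewrite linearP !mxE.
pose phiL : {linear E -> k^o} := HB.pack (fun h => f h 0 1 : k^o)
   (GRing.isLinear.Build k E k^o _ _ phi_lin).
exists (linfun phiL); split=> [h h'|||i]; rewrite !lfunE //=.
- have [_ f2 _] := f_tri h; have [_ _ f3] := f_tri h'.
  by rewrite rmorphM mul2 f2 f3 addrC.
- by rewrite rmorph1 !mxE.
- by rewrite fc !mxE.
- by rewrite fx !mxE mulr1.
Qed.

Lemma skew_functionals chi psi s (A : 'M[k]_n) :
    s * s = 1 -> is_character chi s -> is_character psi (- s) ->
  exists phi, forall j, is_skew_functional chi psi (A^~ j) (phi j).
Proof.
move=> ss chiP psiP.
have [phi phiP] := fin_all_exists (fun j => skew_functional (A^~ j) ss chiP psiP).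
by exists phi.
Qed.

End En.

Section SkewAction.
Variables (k : fieldType) (n : nat) (E : hopfAlgebra k) (c : E) (x : 'I_n -> E).
Variables (gam : 'Hom(E, k^o)) (gamP : is_character c x gam (- 1)).
Variables (A : 'M[k]_n) (phi phi' : 'I_n -> 'Hom(E, k^o)).
Hypothesis phiP : forall j, is_skew_functional c x counit gam (A^~ j) (phi j).
Hypothesis phi'P : forall j, is_skew_functional c x gam counit (A j) (phi' j).

Variables (M : falgType k) (rho : 'Hom(M, tprod M E)).
Hypothesis rhoP : is_comodule_algebra rho.
Variables (u : M) (v : 'I_n -> M).
Hypotheses (rho_u : rho u = tens u c)
  (rho_v : forall i, rho (v i) = tens 1 (x i) + tens (v i) c).

Let g := dual_act rho gam.
Let D j := dual_act rho (phi j).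
Let D' j := dual_act rho (phi' j).

Lemma dual_act_counit d : dual_act rho counit d = d.
Proof. by have [[_ counit_rho] _ _] := rhoP; rewrite dual_actE counit_rho. Qed.

Lemma act_grading1 : g 1 = 1.
Proof.
have [gam1 _ _ _] := gamP; have [_ rho1 _] := rhoP.
by rewrite /g (dual_act_tens _ rho1) gam1 scale1r.
Qed.

Lemma act_gradingM a b : g (a * b) = g a * g b.
Proof.
have [_ gamM _ _] := gamP.
rewrite /g (dual_act_mul (phi1 := gam) (psi1 := gam) (phi2 := 0) (psi2 := 0)) //.
  suff -> : dual_act rho 0 a = 0 by rewrite mul0r addr0.
  by rewrite dual_actE /tsum big1 // => i _; rewrite big1 // => j _;
    rewrite zero_lfunE scale0r scaler0.
by move=> h h'; rewrite gamM zero_lfunE mul0r addr0.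
Qed.

Lemma act_derivM j a b : D j (a * b) = D j a * g b + a * D j b.
Proof.
have [phiM _ _ _] := phiP j.
by rewrite /D (dual_act_mul _ _ rhoP phiM) dual_act_counit.
Qed.

Lemma act_derivM' j a b : D' j (a * b) = D' j a * b + g a * D' j b.
Proof.
have [phiM _ _ _] := phi'P j.
by rewrite /D' (dual_act_mul _ _ rhoP phiM) dual_act_counit.
Qed.

Lemma act_grading_u : g u = - u.
Proof.
have [_ _ gamc _] := gamP.
by rewrite /g (dual_act_tens _ rho_u) gamc scaleN1r.
Qed.

Lemma act_grading_v i : g (v i) = - v i.
Proof.
have [_ _ gamc gamx] := gamP.
by rewrite /g (dual_act_skew_primitive _ (rho_v i)) gamc gamx scale0r add0r scaleN1r.
Qed.

Lemma act_deriv_u j : D j u = 0.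
Proof. by have [_ _ phic _] := phiP j; rewrite /D (dual_act_tens _ rho_u) phic scale0r. Qed.

Lemma act_deriv_v j i : D j (v i) = (A i j)%:A.
Proof.
have [_ _ phic phix] := phiP j.
by rewrite /D (dual_act_skew_primitive _ (rho_v i)) phic phix scale0r addr0.
Qed.

Lemma act_deriv_u' j : D' j u = 0.
Proof. by have [_ _ phic _] := phi'P j; rewrite /D' (dual_act_tens _ rho_u) phic scale0r. Qed.

Lemma act_deriv_v' j i : D' j (v i) = (A j i)%:A.
Proof.
have [_ _ phic phix] := phi'P j.
by rewrite /D' (dual_act_skew_primitive _ (rho_v i)) phic phix scale0r addr0.
Qed.

Lemma act_deriv1 j : D j 1 = 0.
Proof.
have [_ phi1 _ _] := phiP j; have [_ rho1 _] := rhoP.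
by rewrite /D (dual_act_tens _ rho1) phi1 scale0r.
Qed.

Lemma act_deriv1' j : D' j 1 = 0.
Proof.
have [_ phi1 _ _] := phi'P j; have [_ rho1 _] := rhoP.
by rewrite /D' (dual_act_tens _ rho1) phi1 scale0r.
Qed.

End SkewAction.

(** * The universal form as an iterated contraction *)

Section Monomials.
Variables (k : fieldType) (n : nat) (E : hopfAlgebra k) (c : E) (x : 'I_n -> E).
Hypothesis E_is_En : is_En c x.

Let relE : En_rel c x. Proof. by case: E_is_En => [[]]. Qed.
Let cc : c * c = 1. Proof. by case: relE => <-. Qed.
Let xc i : x i * c = - (c * x i).
Proof. by case: relE => _ /(_ i)/eqP; rewrite addr_eq0 => /eqP ->; rewrite opprK. Qed.
Let xx i j : x i * x j = - (x j * x i).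
Proof. by case: relE => _ _ /(_ i j)/eqP; rewrite addr_eq0 => /eqP. Qed.
Let x2 i : x i * x i = 0. Proof. by case: relE => _ _ _ /(_ i). Qed.

Let prod_rem i s : i \in s -> exists b : bool,
  \prod_(j <- s) x j = (-1) ^+ b *: (x i * \prod_(j <- rem i s) x j).
Proof.
elim: s => //= j s IHs; rewrite inE eq_sym big_cons.
have [->|ji] /= := eqVneq j i; first by exists false; rewrite scale1r.
case/IHs=> b ->; exists (~~ b); rewrite big_cons -scalerAr !mulrA (xx i j).
by rewrite mulNr scalerN -scaleNr signrN opprK.
Qed.

Let prod_perm s t : perm_eq s t -> exists b : bool,
  \prod_(i <- s) x i = (-1) ^+ b *: \prod_(i <- t) x i.
Proof.
elim: s t => [|i s IHs] t.
  by rewrite perm_sym => /perm_nilP ->; exists false; rewrite scale1r.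
move=> st; have i_t : i \in t by rewrite -(perm_mem st) mem_head.
have [b ->] := prod_rem i_t.
have : perm_eq s (rem i t) by rewrite -(perm_cons i) (permPl st) perm_to_rem.
case/IHs=> b' Es; exists (b (+) b'); rewrite big_cons Es -scalerAr scalerA.
by rewrite -signr_addb [b (+) b']addbC -addbA addbb addbF.
Qed.

(** The span of the c^a x_P is stable under left multiplication by the generators:
    words in the x_i are reordered up to sign, and a repeated x_i gives 0. *)
Lemma En_basis_ind (P : E -> Prop) : linear_pred P ->
  (forall (a : bool) F, P (c ^+ a * xprod x F)) -> forall h, P h.
Proof.
move=> lP Pb.
(* The span of the c^a x_P as a predicate, which the two nested inductions need. *)
pose Q h := forall P : E -> Prop, linear_pred P ->
  (forall (a : bool) F, P (c ^+ a * xprod x F)) -> P h.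
suff Q_all : forall h, Q h by move=> h; apply: Q_all.
have lQ : linear_pred Q.
  by move=> a h h' Qh Qh' P' lP' P'b; apply: (lP'); [apply: Qh|apply: Qh'].
have Qb (a : bool) F : Q (c ^+ a * xprod x F) by move=> P' _; apply.
have Q1 : Q 1 by have := Qb false set0; rewrite /xprod enum_set0 big_nil mulr1.
have lQmul y : linear_pred (fun h => Q (y * h)).
  by move=> a h h' /= Qh Qh'; rewrite mulrDr -scalerAr; exact: (lQ _ _ _ Qh Qh').
apply: (En_lgenerated E_is_En) => // [h Qh|i h Qh].
  apply: (Qh (fun h => Q (c * h))) => // a F; rewrite mulrA -exprS.
  by case: a => /=; [rewrite expr2 cc; exact: (Qb false)|exact: (Qb true)].
apply: (Qh (fun h => Q (x i * h))) => // a F.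
suff Qxx : Q (c ^+ a * (x i * xprod x F)).
  case: a Qxx => /=; last by rewrite !mul1r.
  rewrite expr1 !mulrA xc mulNr => Qxx; rewrite -scaleN1r.
  exact: (linear_predZ lQ Q1).
case: (boolP (i \in F)) => iF.
  have iF' : i \in enum F by rewrite mem_enum.
  have [b] := prod_rem iF'; rewrite -/(xprod x F) => ->.
  by rewrite -scalerAr mulrA x2 mul0r scaler0 mulr0; apply: linear_pred0 Q1.
have [|b] := @prod_perm (i :: enum F) (enum (i |: F)).
  apply: uniq_perm; rewrite /= ?mem_enum ?iF ?enum_uniq // => j.
  by rewrite inE !mem_enum in_setU1.
rewrite big_cons -!/(xprod x _) => ->; rewrite -scalerAr.
exact: (linear_predZ lQ Q1).
Qed.

End Monomials.

Section Pairing.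
Import FalgLfun.
Variables (k : fieldType) (two_neq0 : 2%:R != 0 :> k) (n : nat).
Variables (E : hopfAlgebra k) (c : E) (x : 'I_n -> E) (E_is_En : is_En c x).
Variables (gam : 'Hom(E, k^o)) (gamP : is_character c x gam (- 1)).
Variables (A : 'M[k]_n) (phi phi' : 'I_n -> 'Hom(E, k^o)).
Hypothesis phiP : forall j, is_skew_functional c x counit gam (A^~ j) (phi j).
Hypothesis phi'P : forall j, is_skew_functional c x gam counit (A j) (phi' j).

Let g : 'End(E) := dual_act comul gam.
Let D j : 'End(E) := dual_act comul (phi j).
Let D' j : 'End(E) := dual_act comul (phi' j).
Let comE := comul_comodule E.
Let comc : comul c = tens c c. Proof. by case: E_is_En => _ []. Qed.
Let comx i : comul (x i) = tens 1 (x i) + tens (x i) c.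
Proof. by case: E_is_En => _ []. Qed.

Let g1 : g 1 = 1. Proof. exact: (act_grading1 gamP comE). Qed.
Let gM a b : g (a * b) = g a * g b. Proof. exact: (act_gradingM gamP comE a b). Qed.
Let gc : g c = - c. Proof. exact: (act_grading_u gamP comc). Qed.
Let gx i : g (x i) = - x i. Proof. exact: (act_grading_v gamP comx i). Qed.
Let DM j a b : D j (a * b) = D j a * g b + a * D j b.
Proof. exact: (act_derivM phiP comE j a b). Qed.
Let D'M j a b : D' j (a * b) = D' j a * b + g a * D' j b.
Proof. exact: (act_derivM' phi'P comE j a b). Qed.
Let Dc j : D j c = 0. Proof. exact: (act_deriv_u phiP comc j). Qed.
Let Dx j i : D j (x i) = (A i j)%:A. Proof. exact: (act_deriv_v phiP comx j i). Qed.
Let D'c j : D' j c = 0. Proof. exact: (act_deriv_u' phi'P comc j). Qed.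
Let D'x j i : D' j (x i) = (A j i)%:A. Proof. exact: (act_deriv_v' phi'P comx j i). Qed.
Let D1 j : D j 1 = 0. Proof. exact: (act_deriv1 phiP comE j). Qed.
Let D'1 j : D' j 1 = 0. Proof. exact: (act_deriv1' phi'P comE j). Qed.

Let rgenEc : @rgenerated k (E^c : falgType k) _ (gens c x).
Proof.
by move=> P lP P1 Pe; apply: (agenv_lgenerated (En_full E_is_En)).
Qed.

Let gens_g i : g (gens c x i) = - gens c x i.
Proof. by rewrite /gens; case: split. Qed.

Let DMc j : @skew_derivation k (E^c : falgType k) g (D j).
Proof. by move=> a b; rewrite [LHS](DM j b a) addrC. Qed.

Let D_gens j i : D j (gens c x i) = (gens 0 (A^~ j) i)%:A.
Proof. by rewrite /gens; case: split => a; rewrite ?Dc ?scale0r ?Dx. Qed.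

Let gg h : g (g h) = h.
Proof.
exact: (@grading_involutive k (E^c : falgType k) g g1 (fun a b => gM b a) _ _
  rgenEc gens_g).
Qed.

Let Dg j h : D j (g h) = - g (D j h).
Proof.
exact: (@skew_derivation_grading k (E^c : falgType k) g g1 (fun a b => gM b a) _ _
  rgenEc gens_g _ _ (DMc j) (D_gens j)).
Qed.

Let DD i j h : D i (D j h) = - D j (D i h).
Proof.
exact: (@skew_derivation_anticomm k (E^c : falgType k) g g1 (fun a b => gM b a) _ _
  rgenEc gens_g _ _ _ _ (DMc i) (D_gens i) (DMc j) (D_gens j)).
Qed.

Let D2 i h : D i (D i h) = 0.
Proof.
have /eqP := DD i i h.
by rewrite -addr_eq0 -mulr2n -scaler_nat scaler_eq0 (negPf two_neq0) => /eqP.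
Qed.

(** The map l |-> r(_, l) from E(n) to its dual with convolution is an
    antihomomorphism that sends c to gam and x_j to phi_j; in terms of the action of
    the dual on E(n) it removes generators from the second argument. *)
Definition is_pairing (r : E -> E -> k) :=
  [/\ forall l, scalar (r^~ l), forall h, scalar (r h),
      forall h, r h 1 = counit h, forall h l, r h (c * l) = r (g h) l
    & forall j h l, r h (x j * l) = r (D j h) l].

(** The operators g and D_j on E(n) satisfy the relations of E(n), so there is an
    algebra map Th from E(n) to End(E(n)), where the product of End is composition in
    the reversed order, and r(h, l) is the counit of Th(l)(h). *)
Lemma pairing_exists : exists r, is_pairing r.
Proof.
have [[_ init] _ _ _] := E_is_En.
have [|Th [[Thc Thx] _]] := init 'End(E) g D.
  split=> [|i|i j|i]; apply/lfunP => h; rewrite ?expr2 ?add_lfunE ?lfun_mulE ?zero_lfunE.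
  - by rewrite gg id_lfunE.
  - by rewrite Dg addNr.
  - by rewrite DD addNr.
  - exact: D2.
exists (fun h l => counit (Th l h)); split=> [l|h|h|h l|j h l].
- by move=> a h h'; rewrite !linearP.
- by move=> a l l'; rewrite linearP add_lfunE scale_lfunE linearP.
- by rewrite rmorph1 id_lfunE.
- by rewrite rmorphM /= lfun_mulE Thc.
- by rewrite rmorphM /= lfun_mulE Thx.
Qed.

Variables (r : E -> E -> k) (rP : is_pairing r).

Let rDl l h h' : r (h + h') l = r h l + r h' l.
Proof. by case: rP => rl _ _ _ _; have := rl l 1 h h'; rewrite scale1r mul1r. Qed.
Let r0l l : r 0 l = 0.
Proof. by apply: (addrI (r 0 l)); rewrite -rDl !addr0. Qed.
Let rZl l a h : r (a *: h) l = a * r h l.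
Proof. by case: rP => rl _ _ _ _; have := rl l a h 0; rewrite r0l !addr0. Qed.
Let rNl l h : r (- h) l = - r h l.
Proof. by rewrite -scaleN1r rZl mulN1r. Qed.
Let rDr h l l' : r h (l + l') = r h l + r h l'.
Proof. by case: rP => _ rl _ _ _; have := rl h 1 l l'; rewrite scale1r mul1r. Qed.
Let r0r h : r h 0 = 0.
Proof. by apply: (addrI (r h 0)); rewrite -rDr !addr0. Qed.
Let rZr h a l : r h (a *: l) = a * r h l.
Proof. by case: rP => _ rl _ _ _; have := rl h a l 0; rewrite r0r !addr0. Qed.
Let rNr h l : r h (- l) = - r h l.
Proof. by rewrite -scaleN1r rZr mulN1r. Qed.

Let eps1 : counit (1 : E) = 1. Proof. exact: counit1. Qed.
Let epsM (a b : E) : counit (a * b) = counit a * counit b. Proof. exact: counitM. Qed.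
Let epsc : counit c = 1. Proof. by case: E_is_En => _ _ []. Qed.
Let epsx i : counit (x i) = 0. Proof. by case: E_is_En => _ _ []. Qed.

Lemma pairing_1l l : r 1 l = counit l.
Proof.
have [_ _ r1 rc rx] := rP.
move: l; apply: (En_lgenerated E_is_En) => [a l l' El El'||l El|i l El].
- by rewrite rDr rZr El El' linearP.
- exact: r1.
- by rewrite rc g1 El epsM epsc mul1r.
- by rewrite rx D1 r0l epsM epsx mul0r.
Qed.

Lemma pairing_cr h l : r (l * c) h = r l (g h).
Proof.
have [_ _ r1 rc rx] := rP.
move: h l; apply: (En_lgenerated E_is_En) => [a h h' Eh Eh' l|l|h Eh l|i h Eh l].
- by rewrite linearP rDr rZr Eh Eh' rDr rZr.
- by rewrite g1 !r1 epsM epsc mulr1.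
- by rewrite rc !gM gc mulrN mulNr rNl Eh rNr rc.
- by rewrite rx DM Dc mulr0 addr0 gc mulrN rNl Eh gM gx mulNr rNr rx.
Qed.

(** The mirror rule for the first argument. The induction on h only uses the
    rules for the second argument and the Leibniz rules of D_i and D'_j, which meet
    at D_i(x_j) = D'_j(x_i). *)
Lemma pairing_xr j h l : r (l * x j) h = r l (D' j h).
Proof.
have [_ _ r1 rc rx] := rP.
move: h l; apply: (En_lgenerated E_is_En) => [a h h' Eh Eh' l|l|h Eh l|i h Eh l].
- by rewrite linearP rDr rZr Eh Eh' rDr rZr.
- by rewrite D'1 r1 r0r epsM epsx mulr0.
- by rewrite rc gM gx mulrN rNl Eh D'M D'c mul0r add0r gc mulNr rNr rc.
- rewrite rx DM gx Dx mulrN -scalerAr mulr1 rDl rNl rZl Eh D'M D'x gx.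
  by rewrite -scalerAl mul1r mulNr rDr rZr rNr rx addrC.
Qed.

(** Words with arbitrary letters: contraction deletes one letter, and this form
    is stable under that. *)
Definition word s (p : 'I_s -> 'I_n) : E := \prod_(i < s) x (p i).

Lemma wordS s (p : 'I_s.+1 -> 'I_n) :
  word p = x (p ord0) * word (fun i => p (lift ord0 i)).
Proof. exact: big_ord_recl. Qed.

Lemma word0 (p : 'I_0 -> 'I_n) : word p = 1. Proof. exact: big_ord0. Qed.

Lemma word_grading s (p : 'I_s -> 'I_n) : g (word p) = (-1) ^+ s *: word p.
Proof.
elim: s p => [|s IHs] p; first by rewrite word0 g1 scale1r.
by rewrite wordS gM gx IHs -scalerAr mulNr exprS mulN1r scaleNr scalerN.
Qed.

Lemma word_deriv s (p : 'I_s.+1 -> 'I_n) j : D j (word p) =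
  \sum_(i < s.+1) ((-1) ^+ (s + i) * A (p i) j) *: word (fun l => p (lift i l)).
Proof.
elim: s p => [|s IHs] p.
  by rewrite big_ord1 wordS !word0 mulr1 Dx mul1r.
rewrite wordS DM Dx -scalerAl mul1r word_grading IHs mulr_sumr.
rewrite [RHS]big_ord_recl addn0 scalerA mulrC; congr (_ *: _ + _).
apply: eq_bigr => i _; rewrite -scalerAr wordS lift0 addSn addnS !exprS.
have -> : lift (lift ord0 i) ord0 = ord0 by apply: val_inj.
rewrite !mulN1r opprK; congr (_ *: (_ * _)).
apply: eq_bigr => l _; congr (x (p _)); apply: val_inj.
by rewrite /= /bump !leq0n !add1n ltnS addnS.
Qed.

(** The exponent of the sign of the reversal of s + 1 letters, recursively. *)
Let tri s : (s.+1 * (s.+1 - 1))./2 = (s + (s * (s - 1))./2)%N.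
Proof. by rewrite !subn1 -!bin2 binS bin1 addnC. Qed.

(** Contracting by the first letter of f is the Laplace expansion of the determinant
    along its first column; the sign comes from D_j passing the letters to the right
    of the deleted one. *)
Lemma pairing_word s (p f : 'I_s -> 'I_n) : r (word p) (word f) =
  (-1) ^+ (s * (s - 1))./2 * \det (\matrix_(i, j) A (p i) (f j)).
Proof.
have [_ _ r1 rc rx] := rP.
elim: s p f => [|s IHs] p f; first by rewrite !word0 r1 eps1 det_mx00 mul1r.
rewrite [word f]wordS rx word_deriv.
rewrite (big_morph (r^~ _) (rDl _) (r0l _)) (expand_det_col _ ord0) mulr_sumr.
apply: eq_bigr => i _; rewrite rZl IHs /cofactor !mxE addn0 tri !exprD.
set d := \det _; set d' := \det _; have -> : d' = d.
  by congr (\det _); apply/matrixP => a b; rewrite !mxE.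
by ring.
Qed.

Lemma pairing_word_neq s t (p : 'I_s -> 'I_n) (f : 'I_t -> 'I_n) :
  s != t -> r (word p) (word f) = 0.
Proof.
have [_ _ r1 rc rx] := rP.
elim: t s p f => [|t IHt] [|s] p f st //.
- by rewrite word0 r1 wordS epsM epsx mul0r.
- by rewrite word0 wordS rx D1 r0l.
rewrite [word f]wordS rx word_deriv.
rewrite (big_morph (r^~ _) (rDl _) (r0l _)) big1 // => i _.
by rewrite rZl IHt ?mulr0.
Qed.

Let pairing_c_word s (f : 'I_s -> 'I_n) h : r (c * h) (word f) = r h (word f).
Proof.
have [_ _ r1 rc rx] := rP.
elim: s f h => [|s IHs] f h; first by rewrite word0 !r1 epsM epsc mul1r.
by rewrite wordS !rx DM Dc mul0r add0r IHs.
Qed.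

(** c on the right multiplies by the parity of the left argument; c on the left is
    invisible once the right argument has no c. *)
Lemma pairing_basis (a b : bool) s t (p : 'I_s -> 'I_n) (f : 'I_t -> 'I_n) :
  r (c ^+ b * word p) (c ^+ a * word f) =
  (-1) ^+ (a * (b + s)) * r (word p) (word f).
Proof.
have [_ _ r1 rc rx] := rP.
have strip h : r (c ^+ b * h) (word f) = r h (word f).
  by case: b; rewrite ?mul1r ?pairing_c_word.
case: a => /=; last by rewrite mul0n !expr0 !mul1r strip.
rewrite expr1 rc gM word_grading -scalerAr rZl; case: b strip => strip /=.
  by rewrite gc mulNr rNl strip mul1n exprS mulN1r mulrN mulNr.
by rewrite g1 mul1r mul1n.
Qed.

Lemma xprod_word (F : {set 'I_n}) s (Fs : #|F| = s) (d : 'I_s -> 'I_n) :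
  xprod x F = word (fun j => nth (d j) (enum F) j).
Proof.
rewrite cardE in Fs; subst s; rewrite /xprod big_tnth.
by apply: eq_bigr => j _; rewrite (tnth_nth (d j)).
Qed.

Lemma xprod_enum (F : {set 'I_n}) : xprod x F = word (fun i : 'I_#|F| => enum_val i).
Proof.
rewrite (xprod_word (erefl #|F|) enum_val).
by apply: eq_bigr => i _; rewrite -enum_val_nth.
Qed.

Lemma En_basisE (a : bool) (F : {set 'I_n}) :
  c ^+ a * xprod x F = (En_basis c x)`_(enum_rank (a, F)).
Proof. by rewrite -tnth_nth tnth_mktuple enum_rankK. Qed.

Lemma pairing_xprod_diag (F : {set 'I_n}) : A = 1%:M ->
  r (xprod x F) (xprod x F) = (-1) ^+ (#|F| * (#|F| - 1))./2.
Proof.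
move=> A1; rewrite !xprod_enum pairing_word.
set M := \matrix_(i, j) _; have -> : M = 1%:M; last by rewrite det1 mulr1.
by apply/matrixP => i j; rewrite !mxE A1 mxE (inj_eq enum_val_inj).
Qed.

(** If P and F have equal size, an element of F outside P gives a zero column of the
    minor of the identity matrix. *)
Lemma pairing_xprod_neq (P F : {set 'I_n}) :
  A = 1%:M -> P != F -> r (xprod x P) (xprod x F) = 0.
Proof.
move=> A1 PF; case: (eqVneq #|P| #|F|) => [cardPF|neq]; last first.
  by rewrite !xprod_enum pairing_word_neq.
rewrite (xprod_word cardPF enum_val) xprod_enum pairing_word.
have /subsetPn[j jF jP] : ~~ (F \subset P).
  by apply: contra PF => FP; rewrite eq_sym eqEcard FP cardPF /=.
rewrite (expand_det_col _ (enum_rank_in jF j)) big1 ?mulr0 // => i _.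
rewrite !mxE enum_rankK_in // A1 mxE; case: eqP => [Ej|]; last by rewrite mul0r.
by case/negP: jP; rewrite -Ej -mem_enum mem_nth // -cardE cardPF.
Qed.

Lemma pairing_basis_xprod (a b : bool) (P F : {set 'I_n}) :
  r (c ^+ b * xprod x P) (c ^+ a * xprod x F) =
  (-1) ^+ (a * (b + #|P|)) * r (xprod x P) (xprod x F).
Proof. by rewrite !xprod_enum pairing_basis. Qed.

(** For A = 1 the pairing is diagonal in P up to the 2 x 2 blocks with entries
    (-1)^(a b), which are invertible as 2 is. *)
Lemma En_basis_free_of_pairing : A = 1%:M -> free (En_basis c x).
Proof.
move=> A1; apply/freeP => z z0.
pose w a F := z (enum_rank (a, F)).
have sum0 (a : bool) F : w false F + (-1) ^+ a * w true F = 0.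
  have : r (\sum_i z i *: (En_basis c x)`_i) (c ^+ a * xprod x F) = 0.
    by rewrite z0 r0l.
  rewrite (big_morph (r^~ _) (rDl _) (r0l _)).
  rewrite (reindex (@enum_rank _)); last first.
    by exists enum_val => i _; rewrite ?enum_rankK ?enum_valK.
  pose T b P := r (w b P *: (c ^+ b * xprod x P)) (c ^+ a * xprod x F).
  rewrite (eq_bigr (fun p => T p.1 p.2)); last first.
    by case=> b P _; rewrite /T (En_basisE b).
  have T_sum b : \sum_P T b P = T b F.
    rewrite (bigD1 F) //= big1 ?addr0 // => P PF.
    by rewrite /T rZl pairing_basis_xprod pairing_xprod_neq // !mulr0.
  rewrite -(pair_bigA _ T) big_bool !T_sum.
  rewrite /T !rZl !pairing_basis_xprod pairing_xprod_diag // !mulrA /= -mulrDl.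
  move/eqP; rewrite mulf_eq0 signr_eq0 orbF => /eqP E0.
  apply/eqP; rewrite -(inj_eq (mulIf (_ : (-1) ^+ (a * #|F|) != 0))) ?signr_eq0 //.
  rewrite mul0r -E0 add0n mulnDr muln1 exprD; apply/eqP; ring.
have w0 F : w false F = 0 /\ w true F = 0.
  have := sum0 false F; have := sum0 true F; rewrite expr1 mulN1r mul1r.
  move/eqP; rewrite subr_eq0 => /eqP -> /eqP.
  rewrite -mulr2n -mulr_natl mulf_eq0 (negPf two_neq0) /= => /eqP w1.
  by rewrite w1.
move=> i; rewrite -(enum_valK i); case: (enum_val i) => a F.
by have [] := w0 F; case: a.
Qed.

(** Once the c^a x_P are known to be a basis, only one term P, F of the sum survives,
    and its sum over permutations is the determinant of [pairing_word]. *)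
Lemma rA_xprod (P F : {set 'I_n}) (a b : bool) : free (En_basis c x) ->
  rA c x A (c ^+ b * xprod x P) (c ^+ a * xprod x F) =
  r (c ^+ b * xprod x P) (c ^+ a * xprod x F).
Proof.
move=> basis_free.
have dual (a' b' : bool) (P' F' : {set 'I_n}) :
    En_dual c x a' P' (c ^+ b' * xprod x F') = ((b' == a') && (F' == P'))%:R.
  rewrite /En_dual En_basisE coord_free // (inj_eq enum_rank_inj).
  by rewrite xpair_eqE.
(* The four dual basis terms of the form combine into the sign that c contributes. *)
have bracket s : (b == false)%:R * (a == false)%:R
    + (b == true)%:R * (a == false)%:R
    + (-1) ^+ s * ((b == false)%:R * (a == true)%:R)
    - (-1) ^+ s * ((b == true)%:R * (a == true)%:R) = (-1) ^+ (a * (b + s)) :> k.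
  by case: a b => [] []; rewrite /= ?mul0n ?mul1n ?add1n ?add0n ?exprS; ring.
rewrite pairing_basis_xprod /rA; set sgn := (-1) ^+ (a * _).
pose term (P' F' : {set 'I_n}) : k :=
  (-1) ^+ (#|P'| * (#|P'| - 1))./2 *
  \sum_(eta : 'S_#|P'|) (-1) ^+ eta * rA_coef A F' eta *
    (((P == P') && (F == F'))%:R * sgn).
transitivity (\sum_(P' : {set 'I_n}) \sum_(F' : {set 'I_n} | #|F'| == #|P'|) term P' F').
  apply: eq_bigr => P' _; rewrite mulr_sumr; apply: eq_bigr => F' _.
  congr (_ * _); apply: eq_bigr => eta _; congr (_ * _); rewrite !dual /sgn.
  case: (eqVneq P P') => [<-|_]; last first.
    by rewrite !andbF /= !(mul0r, mulr0) !addr0 subr0.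
  case: (eqVneq F F') => [_|_]; last first.
    by rewrite !andbF /= !(mul0r, mulr0) !addr0 subr0.
  by rewrite !andbT bracket mul1r.
have term_neq (P' F' : {set 'I_n}) : (P == P') && (F == F') = false -> term P' F' = 0.
  move=> PF; rewrite /term big1 ?mulr0 // => eta _.
  by rewrite PF mul0r mulr0.
rewrite (bigD1 P) //= [X in _ + X]big1 ?addr0; last first.
  by move=> P' PP'; rewrite big1 // => F' _; rewrite term_neq // eq_sym (negPf PP').
case: (eqVneq #|F| #|P|) => [cardFP|cardFP]; last first.
  rewrite big1 => [|F' cardF'].
    by rewrite !xprod_enum pairing_word_neq 1?eq_sym // mulr0.
  rewrite term_neq // eqxx /=; apply: contraNF cardFP => /eqP ->.
  exact: cardF'.
rewrite (bigD1 F) ?cardFP //= big1 ?addr0; last first.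
  by move=> F' /andP[_ FF']; rewrite term_neq // eqxx eq_sym (negPf FF').
rewrite /term !eqxx mul1r -mulr_suml [RHS]mulrC mulrA; congr (_ * _).
rewrite (xprod_word cardFP enum_val) xprod_enum pairing_word; congr (_ * _).
apply: eq_bigr => eta _; congr (_ * _); apply: eq_bigr => i _; rewrite mxE.
by congr (A _ _); apply: set_nth_default; rewrite -cardE cardFP.
Qed.

Lemma rA_pairing : free (En_basis c x) -> forall h l, rA c x A h l = r h l.
Proof.
move=> basis_free h l; have [rl rr _ _ _] := rP.
have dual_lin (b : bool) P a y y' : En_dual c x b P (a *: y + y') =
    a * En_dual c x b P y + En_dual c x b P y'.
  by rewrite /En_dual linearP.
move: l; apply: (En_basis_ind E_is_En) => [a' l l' El El'|a F].
  rewrite [RHS](rr h a' l l') -El -El' /rA mulr_sumr -big_split /=.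
  apply: eq_bigr => P _; rewrite mulrCA -mulrDr; congr (_ * _).
  rewrite mulr_sumr -big_split /=; apply: eq_bigr => F _.
  rewrite mulr_sumr -big_split /=; apply: eq_bigr => eta _.
  rewrite !dual_lin.
  move: (En_dual c x false P h) (En_dual c x true P h) (En_dual c x false F l).
  move: (En_dual c x true F l) (En_dual c x false F l') (En_dual c x true F l').
  by move: (_ * rA_coef _ _ _) ((-1) ^+ #|P|) => *; ring.
move: h; apply: (En_basis_ind E_is_En) => [a' h h' Eh Eh'|b P].
  rewrite [RHS](rl _ a' h h') -Eh -Eh' /rA mulr_sumr -big_split /=.
  apply: eq_bigr => P _; rewrite mulrCA -mulrDr; congr (_ * _).
  rewrite mulr_sumr -big_split /=; apply: eq_bigr => G _.
  rewrite mulr_sumr -big_split /=; apply: eq_bigr => eta _.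
  rewrite !dual_lin; set l' := _ * xprod _ _.
  move: (En_dual c x false P h) (En_dual c x true P h) (En_dual c x false P h').
  move: (En_dual c x true P h') (En_dual c x false G l') (En_dual c x true G l').
  by move: (_ * rA_coef _ _ _) ((-1) ^+ #|P|) => *; ring.
exact: rA_xprod.
Qed.

End Pairing.

(** * Braided products on a comodule algebra *)

Section CoactionSums.
Variables (k : fieldType) (H : hopfAlgebra k) (M : falgType k).
Variables (rho : 'Hom(M, tprod M H)) (rhoP : is_comodule_algebra rho).
Variables (U : lmodType k) (F : M -> H -> U).
Hypotheses (F_linl : forall h, linear (F^~ h)) (F_linr : forall d, linear (F d)).

Lemma tsum_coactM a b : tsum (rho (a * b)) F = tsum (rho a) (fun a0 a1 =>
  tsum (rho b) (fun b0 b1 => F (a0 * b0) (a1 * b1))).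
Proof.
have [_ _ rhoM] := rhoP; rewrite rhoM (linear_tsum _ _ (tsum_is_linear _)).
by apply: eq_tsum => a0 a1; rewrite tsum_tsum_tens.
Qed.

Lemma tsum_coact_dual phi (d : M) : tsum (rho (dual_act rho phi d)) F =
  tsum (rho d) (fun d0 d1 => F d0 (dual_act comul phi d1)).
Proof.
have [comod _ _] := rhoP; rewrite dual_act_coact // tsum_tsum_tens //.
by apply: eq_tsum => d0 d1; rewrite dual_actE.
Qed.

Let mul_linl b (h : H) : linear (fun a0 =>
  tsum (rho b) (fun b0 b1 => F (a0 * b0) (h * b1))).
Proof.
apply: tsum_linear_fun => b0 b1 s y z.
by rewrite mulrDl -scalerAl F_linl.
Qed.

Let mul_linr b (a0 : M) : linear (fun h : H =>
  tsum (rho b) (fun b0 b1 => F (a0 * b0) (h * b1))).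
Proof.
apply: tsum_linear_fun => b0 b1 s y z.
by rewrite mulrDl -scalerAl F_linr.
Qed.

Lemma tsum_coact_tens_mul a b y z : rho a = tens y z -> tsum (rho (a * b)) F =
  tsum (rho b) (fun b0 b1 => F (y * b0) (z * b1)).
Proof. by move=> rho_a; rewrite tsum_coactM rho_a tsum_tens. Qed.

Lemma tsum_coact_skew_mul a b y z : rho a = tens 1 y + tens a z ->
  tsum (rho (a * b)) F = tsum (rho b) (fun b0 b1 => F b0 (y * b1))
    + tsum (rho b) (fun b0 b1 => F (a * b0) (z * b1)).
Proof.
move=> rho_a; rewrite tsum_coactM rho_a tsumD !tsum_tens //.
by congr (_ + _); apply: eq_tsum => b0 b1; rewrite mul1r.
Qed.

Let mul_linl' b (b0 : M) (b1 : H) : linear (fun a0 => F (b0 * a0) (b1 * b)).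
Proof. by move=> s y z; rewrite mulrDr -scalerAr F_linl. Qed.

Let mul_linr' b0 (a0 : M) (b1 : H) : linear (fun h : H => F (b0 * a0) (b1 * h)).
Proof. by move=> s y z; rewrite mulrDr -scalerAr F_linr. Qed.

Lemma tsum_coact_mul_tens a b y z : rho b = tens y z -> tsum (rho (a * b)) F =
  tsum (rho a) (fun a0 a1 => F (a0 * y) (a1 * z)).
Proof.
move=> rho_b; rewrite tsum_coactM rho_b; apply: eq_tsum => a0 a1.
by rewrite tsum_tens.
Qed.

Lemma tsum_coact_mul_skew a b y z : rho b = tens 1 y + tens b z ->
  tsum (rho (a * b)) F = tsum (rho a) (fun a0 a1 => F a0 (a1 * y))
    + tsum (rho a) (fun a0 a1 => F (a0 * b) (a1 * z)).
Proof.
move=> rho_b; rewrite tsum_coactM rho_b -tsumDr; apply: eq_tsum => a0 a1.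
by rewrite tsumD !tsum_tens // mulr1.
Qed.

End CoactionSums.

Section BraidedProducts.
Variables (k : fieldType) (n : nat) (E : hopfAlgebra k) (c : E) (x : 'I_n -> E).
Variables (gam : 'Hom(E, k^o)) (phi phi' : 'I_n -> 'Hom(E, k^o)).
Variables (r : E -> E -> k) (rP : is_pairing c x gam phi r).
Hypothesis r_1l : forall l, r 1 l = counit l.
Hypothesis r_cr : forall h l, r (l * c) h = r l (dual_act comul gam h).
Hypothesis r_xr : forall j h l, r (l * x j) h = r l (dual_act comul (phi' j) h).

Variables (M : falgType k) (rho : 'Hom(M, tprod M E)).
Hypothesis rhoP : is_comodule_algebra rho.
Variables (u : M) (v : 'I_n -> M).
Hypotheses (rho_u : rho u = tens u c)
  (rho_v : forall i, rho (v i) = tens 1 (x i) + tens (v i) c).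

Let r_linl l a h h' : r (a *: h + h') l = a * r h l + r h' l.
Proof. by case: rP => rl _ _ _ _; exact: rl. Qed.
Let r_linr h a l l' : r h (a *: l + l') = a * r h l + r h l'.
Proof. by case: rP => _ rl _ _ _; exact: rl. Qed.

Let term_linl (d0 : M) h l : linear (fun b0 : M => r h l *: (b0 * d0)).
Proof. by move=> a y z; rewrite mulrDl -scalerAl scalerDr !scalerA mulrC. Qed.

Let term_linr (b0 d0 : M) h : linear (fun l => r h l *: (b0 * d0)).
Proof. by move=> a y z; rewrite r_linr scalerDl scalerA. Qed.

Let term_linl' (b0 : M) h l : linear (fun d0 : M => r h l *: (b0 * d0)).
Proof. by move=> a y z; rewrite mulrDr -scalerAr scalerDr !scalerA mulrC. Qed.

Let term_linr' (b0 d0 : M) l : linear (fun h => r h l *: (b0 * d0)).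
Proof. by move=> a y z; rewrite r_linl scalerDl scalerA. Qed.

(** In the converse algebra this is the multiplication of d by b on the right
    twisted by r, that is, F(1 # b)(d). *)
Definition braided_mulr b d : M := tsum (rho d) (fun d0 d1 =>
  tsum (rho b) (fun b0 b1 => r d1 b1 *: (b0 * d0))).

(** In the converse algebra this is the multiplication of d by a on the left
    twisted by r, that is, G(a # 1)(d). *)
Definition braided_mull a d : M := tsum (rho a) (fun a0 a1 =>
  tsum (rho d) (fun d0 d1 => r a1 d1 *: (d0 * a0))).

Lemma braided_mulr_linl d : linear (braided_mulr^~ d).
Proof.
by apply: tsum_linear_fun => d0 d1 a b b'; rewrite linearP tsum_is_linear.
Qed.

Lemma braided_mulr_linr b : linear (braided_mulr b).
Proof. by move=> a d d'; rewrite /braided_mulr linearP tsum_is_linear. Qed.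

Lemma braided_mull_linl d : linear (braided_mull^~ d).
Proof. by move=> a d' d''; rewrite /braided_mull linearP tsum_is_linear. Qed.

Lemma braided_mull_linr a : linear (braided_mull a).
Proof.
by apply: tsum_linear_fun => d0 d1 a' b b'; rewrite linearP tsum_is_linear.
Qed.

Lemma braided_mulr1 d : braided_mulr 1 d = d.
Proof.
have [_ rho1 _] := rhoP; have [_ _ r1 _ _] := rP.
rewrite -[RHS](dual_act_counit rhoP) dual_actE; apply: eq_tsum => d0 d1.
by rewrite rho1 tsum_tens ?mul1r ?r1.
Qed.

Lemma braided_mull1 d : braided_mull 1 d = d.
Proof.
have [_ rho1 _] := rhoP.
rewrite -[RHS](dual_act_counit rhoP) dual_actE /braided_mull rho1 tsum_tens.
- by apply: eq_tsum => d0 d1; rewrite mulr1 r_1l.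
- by move=> h; apply: tsum_linear_fun => d0 d1.
by move=> z; apply: tsum_linear_fun => d0 d1.
Qed.

Let mulr_act psi b d : braided_mulr b (dual_act rho psi d) =
  tsum (rho d) (fun d0 d1 => tsum (rho b) (fun b0 b1 =>
    r (dual_act comul psi d1) b1 *: (b0 * d0))).
Proof.
rewrite /braided_mulr tsum_coact_dual // => [h|d0]; apply: tsum_linear_fun => b0 b1.
  exact: term_linl'.
exact: term_linr'.
Qed.

Let mull_act psi a d : braided_mull a (dual_act rho psi d) =
  tsum (rho a) (fun a0 a1 => tsum (rho d) (fun d0 d1 =>
    r a1 (dual_act comul psi d1) *: (d0 * a0))).
Proof. by apply: eq_tsum => a0 a1; rewrite tsum_coact_dual. Qed.

Lemma braided_mulr_u b d :
  braided_mulr (u * b) d = u * braided_mulr b (dual_act rho gam d).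
Proof.
have [_ _ _ rc _] := rP; rewrite mulr_act (linear_tsum (h := fun y => u * y)); last first.
  by move=> a y z; rewrite mulrDr scalerAr.
apply: eq_tsum => d0 d1; rewrite (tsum_coact_tens_mul _ _ _ _ rho_u) //.
rewrite (linear_tsum (h := fun y => u * y)); last first.
  by move=> a y z; rewrite mulrDr scalerAr.
by apply: eq_tsum => b0 b1; rewrite rc -scalerAr mulrA.
Qed.

(** The coproduct of x_j splits the coaction of v_j b in two parts: one with x_j in
    the second argument of r, which becomes phi_j acting on d, and one with c, which
    becomes gam. *)
Lemma braided_mulr_v j b d : braided_mulr (v j * b) d =
  braided_mulr b (dual_act rho (phi j) d) + v j * braided_mulr b (dual_act rho gam d).
Proof.
have [_ _ _ rc rx] := rP; rewrite !mulr_act.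
rewrite (linear_tsum (h := fun y => v j * y)); last first.
  by move=> a y z; rewrite mulrDr scalerAr.
rewrite -tsumDr; apply: eq_tsum => d0 d1.
rewrite (tsum_coact_skew_mul _ _ _ _ (rho_v j)) //; congr (_ + _).
  by apply: eq_tsum => b0 b1; rewrite rx.
rewrite (linear_tsum (h := fun y => v j * y)); last first.
  by move=> a y z; rewrite mulrDr scalerAr.
by apply: eq_tsum => b0 b1; rewrite rc -scalerAr mulrA.
Qed.

Lemma braided_mull_u a d :
  braided_mull (a * u) d = braided_mull a (dual_act rho gam d) * u.
Proof.
rewrite mull_act (linear_tsum (h := fun y => y * u)); last first.
  by move=> s y z; rewrite mulrDl scalerAl.
rewrite /braided_mull (tsum_coact_mul_tens _ _ _ _ rho_u); first last.
- by move=> z; apply: tsum_linear_fun => d0 d1.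
- by move=> h; apply: tsum_linear_fun => d0 d1.
- by [].
apply: eq_tsum => a0 a1; rewrite (linear_tsum (h := fun y => y * u)); last first.
  by move=> s y z; rewrite mulrDl scalerAl.
by apply: eq_tsum => d0 d1; rewrite r_cr -scalerAl mulrA.
Qed.

Lemma braided_mull_v j a d : braided_mull (a * v j) d =
  braided_mull a (dual_act rho (phi' j) d) + braided_mull a (dual_act rho gam d) * v j.
Proof.
rewrite !mull_act (linear_tsum (h := fun y => y * v j)); last first.
  by move=> s y z; rewrite mulrDl scalerAl.
rewrite /braided_mull (tsum_coact_mul_skew _ _ _ _ (rho_v j)); first last.
- by move=> z; apply: tsum_linear_fun => d0 d1.
- by move=> h; apply: tsum_linear_fun => d0 d1.
- by [].
congr (_ + _); first by do 2!apply: eq_tsum => *; rewrite r_xr.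
apply: eq_tsum => a0 a1; rewrite (linear_tsum (h := fun y => y * v j)); last first.
  by move=> s y z; rewrite mulrDl scalerAl.
by apply: eq_tsum => d0 d1; rewrite r_cr -scalerAl mulrA.
Qed.

End BraidedProducts.

(** * The cleft extension *)

Section Forms.
Variables (k : fieldType) (n : nat).

(** The matrix of anticommutators of (u, v_1, ..., v_n). *)
Definition clifford_form (alpha : k) (gamma : 'rV[k]_n) (Lambda : 'M[k]_n) : 'M[k]_(1 + n) :=
  block_mx (2 * alpha)%:M gamma gamma^T (Lambda + Lambda^T).

(** The values of the skew derivations on the generators: they are zero at u, and
    zero for the index of u. *)
Definition braiding_form (A : 'M[k]_n) : 'M[k]_(1 + n) := block_mx 0 0 0 A.

Lemma clifford_form_tr alpha gamma Lambda :
  (clifford_form alpha gamma Lambda)^T = clifford_form alpha gamma Lambda.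
Proof. by rewrite tr_block_mx trmxK tr_scalar_mx linearD /= trmxK addrC. Qed.

(** Elimination of the lower left block with the pivot - 2 alpha. *)
Lemma det_forms alpha gamma Lambda A : 2 * alpha != 0 :> k ->
  (\det (braiding_form A - clifford_form alpha gamma Lambda) != 0) =
  (\det ((2 * alpha) *: (A - Lambda - Lambda^T)
         + \matrix_(i, j) (gamma 0 i * gamma 0 j)) != 0).
Proof.
move=> a0; set G := \matrix_(i, j) _.
have GE : G = gamma^T *m gamma.
  by apply/matrixP => i j; rewrite !mxE big_ord1 !mxE.
pose P : 'M[k]_(1 + n) := block_mx 1%:M 0 (- gamma^T) (2 * alpha)%:M.
have detP : \det P = (2 * alpha) ^+ n by rewrite det_lblock det1 mul1r det_scalar.
have PK : P *m (braiding_form A - clifford_form alpha gamma Lambda) =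
    block_mx (- (2 * alpha))%:M (- gamma) 0 ((2 * alpha) *: (A - Lambda - Lambda^T) + G).
  rewrite opp_block_mx add_block_mx mulmx_block !mul1mx !mul0mx !addr0 !add0r.
  rewrite !mulNmx !mulmxN !opprK -GE mul_mx_scalar !mul_scalar_mx subrr.
  by rewrite opprD addrA [G + _]addrC raddfN.
have := congr1 determinant PK; rewrite det_mulmx detP det_ublock det_scalar1.
move=> detK; apply/negb_inj; rewrite !negbK.
have <- : ((2 * alpha) ^+ n * \det (braiding_form A - clifford_form alpha gamma Lambda) == 0)
    = (\det (braiding_form A - clifford_form alpha gamma Lambda) == 0).
  by rewrite mulf_eq0 expf_eq0 (negPf a0) andbF.
by rewrite detK mulf_eq0 oppr_eq0 (negPf a0).
Qed.

End Forms.

Section CleftExtension.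
Variables (k : fieldType) (two_neq0 : 2%:R != 0 :> k) (n : nat).
Variables (A : 'M[k]_n) (alpha : k) (gamma : 'rV[k]_n) (Lambda : 'M[k]_n).
Hypothesis Lambda_trig : is_trig_mx Lambda.
Variables (E : hopfAlgebra k) (c : E) (x : 'I_n -> E) (E_is_En : is_En c x).
Variables (Cl : falgType k) (u : Cl) (v : 'I_n -> Cl) (rho : 'Hom(Cl, tprod Cl E)).
Hypothesis Cl_is_Cl : is_Cl c x alpha gamma Lambda u v rho.

Let presC : is_presented (@Cl_rel k n alpha gamma Lambda) u v.
Proof. by case: Cl_is_Cl. Qed.
Let relC : Cl_rel alpha gamma Lambda u v. Proof. by case: presC. Qed.
Let rhoP : is_comodule_algebra rho. Proof. by case: Cl_is_Cl. Qed.
Let rho_u : rho u = tens u c. Proof. by case: Cl_is_Cl. Qed.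
Let rho_v j : rho (v j) = tens 1 (x j) + tens (v j) c.
Proof. by case: Cl_is_Cl. Qed.

Lemma Cl_full : agenv <<codom (gens u v)>>%VS = fullv.
Proof.
apply: (presented_full presC) => S u' v' S1 Eu Ev.
have S1' : algid S = 1 by apply/eqP; rewrite algid_eq1.
have [r1 r2 r3 r4] := relC.
split=> [|i|j|i j ij]; apply: val_inj; rewrite /= ?S1' ?Eu ?Ev.
- exact: r1.
- exact: r2.
- exact: r3.
- exact: r4.
Qed.

Let Q := clifford_form alpha gamma Lambda.
Let e := gens u v.

Lemma Cl_relation i j : e i * e j + e j * e i = (Q i j)%:A.
Proof.
have [r1 r2 r3 r4] := relC.
have vv i' j' : v i' * v j' + v j' * v i' = ((Lambda + Lambda^T) i' j')%:A.
  have trig := elimT is_trig_mxP Lambda_trig.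
  rewrite !mxE; have [ij|ji|/val_inj ->] := ltngtP i' j'.
  - by rewrite [LHS]addrC r4 // (trig i' j') // add0r.
  - by rewrite r4 // (trig j' i') // addr0.
  by rewrite -!expr2 r3 -scalerDl.
rewrite -[i]splitK -[j]splitK /Q /clifford_form.
case: (split i) => i'; case: (split j) => j' /=; rewrite /e ?gens_head ?gens_tail.
- rewrite block_mxEul !ord1 mxE eqxx mulr1n -!expr2 r1 -scalerDl.
  by rewrite -mulr2n mulr_natl.
- by rewrite block_mxEur !ord1 r2.
- by rewrite block_mxEdl !ord1 mxE [LHS]addrC r2.
by rewrite block_mxEdr vv.
Qed.

Variables (gam : 'Hom(E, k^o)) (gamP : is_character c x gam (- 1)).
Variables (phi phi' : 'I_n -> 'Hom(E, k^o)).
Hypothesis phiP : forall j, is_skew_functional c x counit gam (A^~ j) (phi j).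
Hypothesis phi'P : forall j, is_skew_functional c x gam counit (A j) (phi' j).
Variables (r : E -> E -> k) (rP : is_pairing c x gam phi r).

Let g : 'End(Cl) := dual_act rho gam.
Let W := braiding_form A.

Let lgenC : lgenerated e. Proof. exact: agenv_lgenerated Cl_full. Qed.
Let rgenC : rgenerated e. Proof. exact: agenv_rgenerated Cl_full. Qed.

Let g1 : g 1 = 1. Proof. exact: (act_grading1 gamP rhoP). Qed.
Let gM a b : g (a * b) = g a * g b. Proof. exact: (act_gradingM gamP rhoP). Qed.
Let ge i : g (e i) = - e i.
Proof.
rewrite /e /gens; case: (split i) => i'.
  exact: (act_grading_u gamP rho_u).
exact: (act_grading_v gamP rho_v).
Qed.

Let D : 'I_(1 + n) -> 'End(Cl) := gens 0 (fun j => dual_act rho (phi j)).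
Let D' : 'I_(1 + n) -> 'End(Cl) := gens 0 (fun j => dual_act rho (phi' j)).

Let DM j a b : D j (a * b) = D j a * g b + a * D j b.
Proof.
rewrite /D /gens; case: (split j) => j'; last exact: (act_derivM phiP rhoP).
by rewrite !zero_lfunE mul0r mulr0 addr0.
Qed.

Let D'M j : skew_derivation g (D' j).
Proof.
move=> a b; rewrite /D' /gens; case: (split j) => j'.
  by rewrite !zero_lfunE mul0r mulr0 addr0.
by rewrite addrC (act_derivM' phi'P rhoP).
Qed.

Let De i j : D j (e i) = (W i j)%:A.
Proof.
rewrite -[i]splitK -[j]splitK /D /W /braiding_form.
case: (split i) => i'; case: (split j) => j' /=; rewrite /e ?gens_head ?gens_tail.
- by rewrite block_mxEul mxE zero_lfunE scale0r.
- by rewrite block_mxEur mxE (act_deriv_u phiP rho_u) scale0r.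
- by rewrite block_mxEdl mxE zero_lfunE scale0r.
by rewrite block_mxEdr (act_deriv_v phiP rho_v).
Qed.

Let D'e i j : D' j (e i) = (W^T i j)%:A.
Proof.
rewrite mxE -[i]splitK -[j]splitK /D' /W /braiding_form.
case: (split i) => i'; case: (split j) => j' /=; rewrite /e ?gens_head ?gens_tail.
- by rewrite block_mxEul mxE zero_lfunE scale0r.
- by rewrite block_mxEdl mxE (act_deriv_u' phi'P rho_u) scale0r.
- by rewrite block_mxEur mxE zero_lfunE scale0r.
by rewrite block_mxEdr (act_deriv_v' phi'P rho_v).
Qed.

Let mulr_hom : exists R : 'Hom(Cl, 'End(Cl)), forall b d, R b d = braided_mulr r rho b d.
Proof.
apply: bilinear_hom => y; first exact: braided_mulr_linl.
exact: braided_mulr_linr.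
Qed.

Let mull_hom : exists R : 'Hom(Cl, 'End(Cl)), forall b d, R b d = braided_mull r rho b d.
Proof.
apply: bilinear_hom => y; first exact: braided_mull_linl.
exact: braided_mull_linr.
Qed.

Section RightMultiplications.
Variable R : 'Hom(Cl, 'End(Cl)).
Hypothesis RE : forall b d, R b d = braided_mulr r rho b d.

Let lgenCc : @lgenerated k (Cl^c : falgType k) _ e.
Proof. by move=> P lP P1 Pe; apply: rgenC. Qed.

Let rgenCc : @rgenerated k (Cl^c : falgType k) _ e.
Proof. by move=> P lP P1 Pe; apply: lgenC. Qed.

Let eQc i j : (e i : Cl^c) * e j + (e j : Cl^c) * e i = (Q i j)%:A.
Proof.
rewrite [LHS](Cl_relation j i).
suff -> : Q j i = Q i j by [].
have /matrixP/(_ i j) := clifford_form_tr alpha gamma Lambda.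
by rewrite [LHS]mxE.
Qed.

Let DMc j : @skew_derivation k (Cl^c : falgType k) g (D j).
Proof. by move=> a b; rewrite [LHS](DM j b a) addrC. Qed.

Let R1 d : R 1 d = d. Proof. by rewrite RE (braided_mulr1 rP rhoP). Qed.

Let Re (b : Cl) j d : R (e j * b) d = R b (D j d) + e j * R b (g d).
Proof.
rewrite !RE /e /D /gens; case: (split j) => j'; last exact: (braided_mulr_v rP rhoP rho_v).
rewrite zero_lfunE (braided_mulr_u rP rhoP rho_u) -!RE.
by rewrite (linear0 (R b)) add0r.
Qed.

(** [multiplications_span] in the converse algebra, where [braided_mulr] is the
    braided right multiplication. *)
Lemma right_multiplications_span : W - Q \in unitmx ->
  forall X : 'End(Cl), exists t : tprod Cl Cl,
    X = tsum t (fun a b => @amull k (Cl^c : falgType k) a \o R b)%VF.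
Proof.
exact: (@multiplications_span k two_neq0 (Cl^c : falgType k) _ e Q W g D R
  lgenCc rgenCc eQc g1 (fun a b => gM b a) ge DMc De R1 (fun b j => Re b j)).
Qed.

Lemma right_multiplications_singular (w : 'I_(1 + n) -> k) :
    (forall i, \sum_j w j * (W i j - Q i j) = 0) ->
  \sum_j w j *: (R (e j) - @amull k (Cl^c : falgType k) (e j)) = 0.
Proof.
exact: (@annihilation_singular k (Cl^c : falgType k) _ e Q W g D R
  lgenCc eQc g1 (fun a b => gM b a) ge DMc De R1 (fun b j => Re b j)).
Qed.

End RightMultiplications.

Section LeftMultiplications.
Variable R : 'Hom(Cl, 'End(Cl)).
Hypothesis RE : forall b d, R b d = braided_mull r rho b d.

Let r1l l : r 1 l = counit l. Proof. exact: (pairing_1l E_is_En gamP phiP rP). Qed.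
Let rcr h l : r (l * c) h = r l (dual_act comul gam h).
Proof. exact: (pairing_cr E_is_En gamP phiP rP). Qed.
Let rxr j h l : r (l * x j) h = r l (dual_act comul (phi' j) h).
Proof. exact: (pairing_xr E_is_En gamP phiP phi'P rP). Qed.

Let R1 d : R 1 d = d. Proof. by rewrite RE (braided_mull1 rP r1l rhoP). Qed.

Let Re (b : Cl) j d : R (b * e j) d = R b (D' j d) + R b (g d) * e j.
Proof.
rewrite !RE /e /D' /gens; case: (split j) => j'.
  rewrite zero_lfunE (braided_mull_u rP rcr rhoP rho_u) -!RE.
  by rewrite (linear0 (R b)) add0r.
exact: (braided_mull_v rP rcr rxr rhoP rho_v).
Qed.

(** [multiplications_span] in Cl itself: left multiplications of the converse algebra
    are right multiplications of Cl, so the roles of the two sides, and of A and its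
    transpose, are exchanged. *)
Lemma left_multiplications_span : W - Q \in unitmx ->
  forall X : 'End(Cl), exists t : tprod Cl Cl, X = tsum t (fun a b => amull a \o R b)%VF.
Proof.
move=> WQ; apply: (multiplications_span two_neq0 lgenC rgenC Cl_relation g1 gM ge D'M D'e R1 Re).
have -> : W^T - Q = (W - Q)^T by rewrite linearB /= clifford_form_tr.
by rewrite unitmx_tr.
Qed.

End LeftMultiplications.

Let amullc (a y : Cl) : @amull k (Cl^c : falgType k) a y = y * a.
Proof. exact: lfunE. Qed.

Let amulle (a y : Cl) : amull a y = a * y.
Proof. exact: lfunE. Qed.

Let braided_mulr_mul (a b d : Cl) : braided_mulr r rho b d * a =
  tsum (rho d) (fun d0 d1 => tsum (rho b) (fun b0 b1 => r d1 b1 *: (b0 * (d0 * a)))).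
Proof.
rewrite (linear_tsum (h := fun y : Cl => y * a)); last first.
  by move=> s y z; rewrite mulrDl scalerAl.
apply: eq_tsum => d0 d1; rewrite (linear_tsum (h := fun y : Cl => y * a)); last first.
  by move=> s y z; rewrite mulrDl scalerAl.
by apply: eq_tsum => b0 b1; rewrite -scalerAl -mulrA.
Qed.

Let braided_mull_mul (a b d : Cl) : b * braided_mull r rho a d =
  tsum (rho a) (fun a0 a1 => tsum (rho d) (fun d0 d1 => r a1 d1 *: (b * (d0 * a0)))).
Proof.
rewrite (linear_tsum (h := fun y : Cl => b * y)); last first.
  by move=> s y z; rewrite mulrDr scalerAr.
apply: eq_tsum => a0 a1; rewrite (linear_tsum (h := fun y : Cl => b * y)); last first.
  by move=> s y z; rewrite mulrDr scalerAr.
by apply: eq_tsum => d0 d1; rewrite -scalerAr.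
Qed.

Let azumayaFE (R : 'Hom(Cl, 'End(Cl))) (t : tprod Cl Cl) :
    (forall b d, R b d = braided_mulr r rho b d) ->
  azumayaF (A := Cl^c) rho r t =
  tsum t (fun a b => @amull k (Cl^c : falgType k) a \o R b)%VF.
Proof.
move=> RE; apply: eq_tsum => a b; apply: linfun_ext => d.
by rewrite comp_lfunE amullc RE braided_mulr_mul.
Qed.

Let azumayaGE (R : 'Hom(Cl, 'End(Cl))) (t : tprod Cl Cl) :
    (forall a d, R a d = braided_mull r rho a d) ->
  azumayaG (A := Cl^c) rho r t = tsum t (fun a b : Cl => amull b \o R a)%VF.
Proof.
move=> RE; apply: eq_tsum => a b; apply: linfun_ext => d.
by rewrite comp_lfunE [RHS](amulle b (R a d)) RE braided_mull_mul.
Qed.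

Lemma azumaya_of_unit : W - Q \in unitmx -> azumaya (A := Cl^c) rho r.
Proof.
move=> WQ; have dim2 : \dim {: 'M[k]_(\dim {:Cl}, \dim {:Cl})} = \dim {: 'End(Cl)}.
  by rewrite [LHS]dimvf [RHS]dimvf /dim /= !dimvf.
split; first exact: op_comodule_algebra.
- have [R RE] := mulr_hom.
  apply: (surjective_bijective (V := 'M[k]_(\dim {:Cl}, \dim {:Cl})) (W := 'End(Cl)) _ dim2).
    exact: tsum_is_linear.
  move=> X; have [t ->] := right_multiplications_span RE WQ X; exists t.
  by rewrite (azumayaFE _ RE).
have [R RE] := mull_hom.
apply: (surjective_bijective (V := 'M[k]_(\dim {:Cl}, \dim {:Cl})) (W := 'End(Cl)) _ dim2).
  exact: tsum_is_linear.
move=> X; have [t ->] := left_multiplications_span RE WQ X.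
by exists t^T; rewrite (azumayaGE _ RE) tsum_tr.
Qed.

Hypothesis alpha_neq0 : alpha != 0.

(** Apply the coaction to the relation and compare: an element of E(n) spanned by
    1, c and the x_i vanishes. The parity character shows that the coefficient of 1 is
    zero, the skew functionals show it for those of the x_i, and then w_0 u = 0 with
    u invertible. *)
Let independence (w : 'I_(1 + n) -> k) a :
  \sum_j w j *: e j = a%:A -> forall j, w j = 0.
Proof.
pose w0 := w (lshift n ord0); pose w1 j := w (rshift 1 j).
rewrite big_split_ord /= big_ord1 (_ : e _ = u); last exact: gens_head.
rewrite (eq_bigr (fun j => w1 j *: v j)); last by move=> j _; rewrite /e gens_tail.
rewrite -/w0 => wa.
pose x1 := \sum_j w1 j *: x j.
have E0 : tens (1 : Cl) (a *: c + x1 - a *: 1) = 0.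
  pose T1 : {linear E -> tprod Cl E} :=
    HB.pack (tens (1 : Cl)) (GRing.isLinear.Build k E _ _ _ (tens_linr (W := E) (1 : Cl))).
  pose Tc : {linear Cl -> tprod Cl E} :=
    HB.pack (fun y : Cl => tens y c) (GRing.isLinear.Build k Cl _ _ _ (tens_linl (V := Cl) c)).
  have rho_y : rho a%:A = Tc a%:A + T1 x1.
    rewrite -wa linearD linearZ /= rho_u linear_sum.
    rewrite -[tens u c]/(Tc u) -[tens _ c]/(Tc _) linearD linearZ -!addrA.
    congr (_ + _); rewrite -[tens 1 x1]/(T1 x1) !linear_sum -big_split.
    apply: eq_bigr => j _.
    by rewrite !linearZ /= rho_v scalerDr addrC.
  have [_ rho1 _] := rhoP.
  rewrite -[LHS]/(T1 _) linearB linearD.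
  have -> : T1 (a *: c) = Tc a%:A by rewrite !linearZ.
  by rewrite -rho_y !linearZ /= rho1 scalerN subrr.
have {}E0 := tens_eq0r (oner_neq0 _) E0.
have value (f : 'Hom(E, k^o)) : a * f c + \sum_j w1 j * f (x j) - a * f 1 = 0.
  have Ef : f (a *: c + x1 - a *: 1) = 0 by rewrite E0 linear0.
  rewrite -[RHS]Ef linearB linearD linear_sum !linearZ /= scalerN.
  by congr (_ + _ - _); apply: eq_bigr => j _; rewrite linearZ.
have [gam1 _ gamc gamx] := gamP.
have a_eq0 : a = 0.
  have /eqP := value gam; rewrite gamc gam1 big1 => [|j _]; last by rewrite gamx mulr0.
  rewrite addr0 mulrN -opprD oppr_eq0 mulr1 -mulr2n -mulr_natl mulf_eq0.
  by rewrite (negPf two_neq0) => /eqP.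
have w1_eq0 j : w1 j = 0.
  have [|f [_ f1 fc fx]] := skew_functional E_is_En (fun i => (i == j)%:R)
    (mul1r 1) (counit_character E_is_En) (_ : is_character c x gam (- 1)) => //.
  have := value f; rewrite f1 fc !mulr0 add0r subr0 (bigD1 j) //= fx eqxx mulr1.
  by rewrite big1 ?addr0 // => i /negPf ij; rewrite fx ij mulr0.
have w0_eq0 : w0 = 0.
  move: wa; rewrite a_eq0 scale0r big1 ?addr0 => [|j _]; last by rewrite w1_eq0 scale0r.
  move=> w0u; have /eqP := congr1 (fun y => y * u) w0u.
  rewrite -scalerAl mul0r -expr2; have [-> _ _ _] := relC.
  by rewrite scalerA scaler_eq0 mulf_eq0 (negPf alpha_neq0) oner_eq0 !orbF => /eqP.
move=> j; rewrite -[j]splitK; case: (split j) => i /=; last exact: w1_eq0.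
by rewrite ord1.
Qed.

(** A vector in the kernel of W - Q gives y with F(1 # y) = F(y # 1); injectivity
    makes y a scalar. *)
Lemma unit_of_azumaya : azumaya (A := Cl^c) rho r -> W - Q \in unitmx.
Proof.
case=> _ [F' FK _] _; have [R RE] := mulr_hom.
rewrite unitmxE unitfE -det_tr; apply/det0P => -[w w_neq0 /rowP wK0].
case/negP: w_neq0; apply/eqP/rowP => j; rewrite [RHS]mxE.
have singular : \sum_j w 0 j *: (R (e j) - @amull k (Cl^c : falgType k) (e j)) = 0.
  apply: (right_multiplications_singular RE) => i.
  have := wK0 i; rewrite !mxE => wKi; rewrite -[RHS]wKi; apply: eq_bigr => l _.
  by rewrite !mxE.
pose y := \sum_j w 0 j *: e j.
have Ny : R y - @amull k (Cl^c : falgType k) y = 0.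
  apply/lfunP => d; rewrite add_lfunE opp_lfunE zero_lfunE amullc.
  transitivity (\sum_j w 0 j *: (R (e j) d - d * e j)).
    rewrite linear_sum sum_lfunE mulr_sumr -sumrB; apply: eq_bigr => i _.
    by rewrite linearZ scale_lfunE -scalerAr scalerBr.
  have := congr1 (fun X : 'End(Cl) => X d) singular.
  rewrite /= sum_lfunE zero_lfunE => singular_d.
  rewrite -[RHS]singular_d; apply: eq_bigr => i _.
  by rewrite scale_lfunE add_lfunE opp_lfunE amullc.
have R1 : R 1 = \1%VF by apply/lfunP => d; rewrite RE (braided_mulr1 rP rhoP) id_lfunE.
have ty : (-1) *: tens y 1 + tens 1 y = 0 :> tprod Cl Cl.
  have F_tens a b : tsum (tens a b) (fun a b => @amull k (Cl^c : falgType k) a \o R b)%VF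
      = (@amull k (Cl^c : falgType k) a \o R b)%VF.
    rewrite tsum_tens // => [b' s z z'|a' s z z'] /=.
      by rewrite linearP comp_lfunDl comp_lfunZl.
    by rewrite linearP comp_lfunDr comp_lfunZr.
  apply: (can_inj FK); rewrite !(azumayaFE _ RE) tsum0 tsum_is_linear !F_tens.
  apply/lfunP => d; rewrite add_lfunE scale_lfunE !comp_lfunE !amullc R1 mulr1.
  have := congr1 (fun X : 'End(Cl) => X d) Ny.
  rewrite /= add_lfunE opp_lfunE amullc !zero_lfunE id_lfunE => Nyd.
  by rewrite -[RHS]Nyd scaleN1r addrC.
have tens_y : tens 1 y = tens y 1.
  by apply/eqP; rewrite -subr_eq0 addrC -scaleN1r; apply/eqP.
have [a ya] := tens_commuting (oner_neq0 _) tens_y.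
exact: (independence ya).
Qed.

End CleftExtension.

(** * The theorem *)

Section UniversalForm.
Variables (k : fieldType) (two_neq0 : 2%:R != 0 :> k) (n : nat).
Variables (E : hopfAlgebra k) (c : E) (x : 'I_n -> E) (E_is_En : is_En c x).

(** The pairing for the identity matrix separates the c^a x_P. *)
Lemma En_basis_free : free (En_basis c x).
Proof.
have [gam gamP] := sign_character E_is_En.
have [phi phiP] := skew_functionals E_is_En 1%:M (mul1r 1) (counit_character E_is_En) gamP.
have [r rP] := pairing_exists two_neq0 E_is_En gamP phiP.
exact: (En_basis_free_of_pairing two_neq0 E_is_En gamP phiP rP (erefl _)).
Qed.

Lemma rA_is_pairing (A : 'M[k]_n) (gam : 'Hom(E, k^o)) (phi : 'I_n -> 'Hom(E, k^o)) :
    is_character c x gam (- 1) ->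
    (forall j, is_skew_functional c x counit gam (A^~ j) (phi j)) ->
  is_pairing c x gam phi (rA c x A).
Proof.
move=> gamP phiP; have [r rP] := pairing_exists two_neq0 E_is_En gamP phiP.
have rE := rA_pairing E_is_En gamP phiP rP En_basis_free.
have [rl rr r1 rc rx] := rP.
split=> [l a h h'|h a l l'|h|h l|j h l]; rewrite !rE //.
- exact: rl.
- exact: rr.
Qed.

End UniversalForm.

Theorem proposition3p1 (k : fieldType) (char_k : 2%N \notin [pchar k])
    (n : nat) (n_ge1 : (1 <= n)%N)
    (A : 'M[k]_n) (alpha : k) (alpha_neq0 : alpha != 0)
    (gamma : 'rV[k]_n) (Lambda : 'M[k]_n) (Lambda_trig : is_trig_mx Lambda)
    (E : hopfAlgebra k) (c : E) (x : 'I_n -> E) (E_is_En : is_En c x)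
    (Cl : falgType k) (u : Cl) (v : 'I_n -> Cl) (rho : 'Hom(Cl, tprod Cl E))
    (Cl_is_Cl : is_Cl c x alpha gamma Lambda u v rho) :
  azumaya (A := Cl^c) rho (rA c x A) <->
  \det ((2 * alpha) *: (A - Lambda - Lambda^T)
        + \matrix_(i, j) (gamma 0 i * gamma 0 j)) != 0.
Proof.
have two_neq0 : 2%:R != 0 :> k.
  by apply: contraNneq char_k => two0; rewrite inE /= two0.
have [gam gamP] := sign_character E_is_En.
have [phi phiP] := skew_functionals E_is_En A (mul1r 1) (counit_character E_is_En) gamP.
(* The mirror functionals exchange the counit and the parity character. *)
have epsP : is_character c x counit (- - 1).
  by rewrite opprK; exact: counit_character.
have N1N1 : (-1) * (-1) = 1 :> k by rewrite mulrNN mulr1.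
have [phi' phi'P] := skew_functionals E_is_En A^T N1N1 gamP epsP.
have {}phi'P j : is_skew_functional c x gam counit (A j) (phi' j).
  by have [phi'M phi'1 phi'c phi'x] := phi'P j; split=> // i; rewrite phi'x mxE.
have rP := rA_is_pairing two_neq0 E_is_En gamP phiP.
rewrite -(det_forms gamma Lambda A) ?mulf_neq0 // -unitfE -unitmxE; split.
  exact: (unit_of_azumaya two_neq0 Lambda_trig E_is_En Cl_is_Cl gamP phiP rP).
exact: (azumaya_of_unit two_neq0 Lambda_trig E_is_En Cl_is_Cl gamP phiP phi'P rP).
Qed.
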